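(* Let $\mathcal{A}:\mathcal{B}(\mathcal{H}_{\rm c})\to\mathcal{B}(\mathcal{H}_{\rm o})$ be a memoryless quantum channel (a trace-preserving completely positive map between finite-dimensional Hilbert spaces, used as $\mathcal{A}^{\otimes n}$ on $n$ copies). For every rate $R<Q(\mathcal{A})$ there exists an attainable exponent $E>0$ for $\mathcal{A}$ and $R$.
   Context: Fix a base $d$ (a prime; logarithms are taken to base $d$). A code for $\mathcal{A}^{\otimes n}$ is a triple $(\mathcal{K}_n,\mathcal{E}_n,\mathcal{D}_n)$ with $\mathcal{K}_n$ a finite-dimensional Hilbert space and $\mathcal{E}_n:\mathcal{B}(\mathcal{K}_n)\to\mathcal{B}(\mathcal{H}_{\rm c}^{\otimes n})$, $\mathcal{D}_n:\mathcal{B}(\mathcal{H}_{\rm o}^{\otimes n})\to\mathcal{B}(\mathcal{K}_n)$ trace-preserving completely positive maps. For a subspace/space $\mathcal{K}$, $\pi_{\mathcal{K}}$ is the projection onto $\mathcal{K}$ divided by $\dim\mathcal{K}$, and the entanglement fidelity is $F_{\rm e}(\rho,\mathcal{B})=\sum_j|\mathrm{tr}(\rho B_j)|^2$ for a completely positive map $\mathcal{B}$ with Kraus operators $B_j$. A number $R$ is an achievable rate for $\mathcal{A}$ if there is a sequence of codes with $\limsup_{n\to\infty}\frac{1}{n}\log_d\dim\mathcal{K}_n\ge R$ and $\lim_{n\to\infty}F_{\rm e}(\pi_{\mathcal{K}_n},\mathcal{D}_n\mathcal{A}^{\otimes n}\mathcal{E}_n)=1$ (composition of maps). The quantum capacity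 $Q(\mathcal{A})$ is the supremum of achievable rates. A number $E$ is an attainable exponent for $\mathcal{A}$ and rate $R$ if there is a sequence of codes with $\liminf_{n\to\infty}\frac{1}{n}\log_d\dim\mathcal{K}_n\ge R$ and $\liminf_{n\to\infty}-\frac{1}{n}\log_d\big[1-F_{\rm e}(\pi_{\mathcal{K}_n},\mathcal{D}_n\mathcal{A}^{\otimes n}\mathcal{E}_n)\big]\ge E$. *)

(* Defs.v *)
(* mathcomp + real_closed (complex numbers R[i], Kronecker
   product of matrices mxtens) + mathcomp-analysis (ln, limsup/liminf, sup). *)
From mathcomp Require Import all_boot all_order all_algebra.
From mathcomp Require Import complex mxtens.
From mathcomp Require Import all_classical all_reals all_analysis.

Set Implicit Arguments.
Unset Strict Implicit.
Unset Printing Implicit Defensive.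

Import Order.TTheory GRing.Theory Num.Theory.
Local Open Scope ring_scope.
Local Open Scope classical_set_scope.
Import numFieldNormedType.Exports.

(* Operators between finite-dimensional Hilbert spaces C^m -> C^n are
   matrices 'M[R[i]]_(n, m).  A completely positive map
   B(C^m) -> B(C^n) is given by a (finite) family of Kraus operators
   K_j : 'M_(n, m), acting as X |-> \sum_j K_j X K_j^*. *)

(* conjugate transpose *)
Definition adjmx (R : realType) (m n : nat) (A : 'M[R[i]]_(m, n)) : 'M[R[i]]_(n, m) :=
  map_mx (fun z => (z^*)%C) A^T.

(* trace preservation of the CP map with Kraus operators K: \sum_j K_j^* K_j = 1 *)
Definition trace_preserving (R : realType) (m n : nat) (K : seq 'M[R[i]]_(n, m)) : Prop :=
  \sum_(A <- K) (adjmx A *m A) = 1%:M.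

(* Kraus operators of the n-fold tensor power A^{\otimes n}:
   all Kronecker products A_{j_1} (x) ... (x) A_{j_n}. *)
Fixpoint kraus_tpow (R : realType) (m n : nat) (K : seq 'M[R[i]]_(n, m)) (k : nat)
  : seq 'M[R[i]]_(n ^ k, m ^ k) :=
  match k with
  | 0 => [:: 1%:M]
  | k'.+1 => [seq castmx (esym (expnS n k'), esym (expnS m k')) (A *t B)
             | A <- K, B <- kraus_tpow K k']
  end.

(* Kraus operators of the composition D o A o E *)
Definition kraus_comp3 (R : realType) (a b c e : nat)
  (D : seq 'M[R[i]]_(e, c)) (A : seq 'M[R[i]]_(c, b)) (E : seq 'M[R[i]]_(b, a))
  : seq 'M[R[i]]_(e, a) :=
  [seq Dj *m AEj | Dj <- D, AEj <- [seq Aj *m Ej | Aj <- A, Ej <- E]].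

(* squared modulus of a complex number *)
Definition sqmod (R : realType) (z : R[i]) : R := complex.Re z ^+ 2 + complex.Im z ^+ 2.

(* maximally mixed state pi_K on a k-dimensional space *)
Definition maxmixed (R : realType) (k : nat) : 'M[R[i]]_k := (k%:R^-1)%:M.

(* entanglement fidelity F_e(pi_K, B) = \sum_j |tr(pi_K B_j)|^2 *)
Definition ent_fid (R : realType) (k : nat) (B : seq 'M[R[i]]_k) : R :=
  \sum_(Bj <- B) sqmod (\tr (maxmixed R k *m Bj)).

(* a code (K_n, E_n, D_n) for A^{\otimes n}, A : B(C^din) -> B(C^dout) *)
Record code (R : realType) (din dout n : nat) := Code {
  cdim : nat;                                    (* dim K_n *)
  enc : seq 'M[R[i]]_(din ^ n, cdim);            (* Kraus ops of E_n *)
  dec : seq 'M[R[i]]_(cdim, dout ^ n);           (* Kraus ops of D_n *)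
  cdim_gt0 : (0 < cdim)%N;
  enc_tp : trace_preserving enc;
  dec_tp : trace_preserving dec
}.

(* F_e(pi_{K_n}, D_n A^{\otimes n} E_n) *)
Definition code_fid (R : realType) (din dout n : nat)
  (A : seq 'M[R[i]]_(dout, din)) (c : code R din dout n) : R :=
  ent_fid (kraus_comp3 (dec c) (kraus_tpow A n) (enc c)).

(* (1/n) log_d dim K_n *)
Definition code_rate (R : realType) (d n k : nat) : R :=
  (ln (k%:R : R) / ln (d%:R : R)) / n%:R.

(* -(1/n) log_d x, with the value +oo at x = 0 *)
Definition err_exponent (R : realType) (d n : nat) (x : R) : \bar R :=
  if x == 0 then +oo%E else (- (ln x / ln (d%:R : R)) / n%:R)%:E.

Definition achievable_rate (R : realType) (d din dout : nat)
  (A : seq 'M[R[i]]_(dout, din)) (r : R) : Prop :=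
  exists c : forall n, code R din dout n,
    (r%:E <= limn_esup (fun n => (code_rate R d n (cdim (c n)))%:E))%E /\
    (fun n => code_fid A (c n)) @ \oo --> (1 : R).

(* quantum capacity Q(A): supremum of achievable rates (in the extended reals) *)
Definition quantum_capacity (R : realType) (d din dout : nat)
  (A : seq 'M[R[i]]_(dout, din)) : \bar R :=
  ereal_sup [set r%:E | r in achievable_rate d A].

Definition attainable_exponent (R : realType) (d din dout : nat)
  (A : seq 'M[R[i]]_(dout, din)) (E r : R) : Prop :=
  exists c : forall n, code R din dout n,
    (r%:E <= limn_einf (fun n => (code_rate R d n (cdim (c n)))%:E))%E /\
    (E%:E <= limn_einf (fun n => err_exponent d n (1 - code_fid A (c n))))%E.

(* Main.v *)
Require Import Defs.
From mathcomp Require Import all_boot all_order all_algebra.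
From mathcomp Require Import complex mxtens.
From mathcomp Require Import all_classical all_reals all_analysis.
From mathcomp Require Import ring lra zify.
Import Order.TTheory GRing.Theory Num.Theory.
Local Open Scope ring_scope.

Set Implicit Arguments.
Unset Strict Implicit.
Unset Printing Implicit Defensive.

(** Fix a rate above [r] and a block length [m] whose code, of dimension [K], has
    entanglement fidelity at least [1 - eps].  Restricting it to a subspace of
    dimension [2 ^ s <= K] (some coordinate subspace does no worse than the whole
    space, by convexity) turns [m] uses of the channel into one use of a channel on
    [s] qubits whose identity component has weight at least [1 - eps].  On [N] such
    blocks, use as outer code a CSS code, found by random choice of its check
    matrices, that detects every Pauli error acting on at most [2 N / u] blocks; its
    rate tends to 1 as [u] grows.  Averaged over the syndrome cosets of the code, the
    fidelity is at least the weight that the product channel gives to the Pauli errors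
    on at most [N / u] blocks, so for [eps <= 4 ^- u] the infidelity is at most
    [2 ^ N * eps ^ (N / u + 1) <= 2 ^- N].  Since [m] is fixed, this is exponentially
    small in the number [n ~ N * m] of channel uses. *)

(** * Kraus families indexed by finite types *)

Section SquaredModulus.
Context {R : realType}.
Implicit Types (z : R[i]) (x : R).

Lemma sqmod_complex z : (sqmod z)%:C%C = z * conjc z.
Proof.
case: z => a b; apply/eqP; rewrite eq_complex /sqmod /=.
by apply/andP; split; apply/eqP; ring.
Qed.

Lemma sqmod_ge0 z : 0 <= sqmod z.
Proof. by rewrite addr_ge0 ?sqr_ge0. Qed.

Lemma sqmodM z1 z2 : sqmod (z1 * z2) = sqmod z1 * sqmod z2.
Proof.
by apply: complexI; rewrite rmorphM /= !sqmod_complex rmorphM mulrACA.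
Qed.

Lemma sqmod1 : sqmod (1 : R[i]) = 1.
Proof. by rewrite /sqmod /= expr0n expr1n addr0. Qed.

Lemma sqmod_real x : sqmod x%:C%C = x ^+ 2.
Proof. by rewrite /sqmod /= expr0n addr0. Qed.

Lemma sqmod_nat n : sqmod (n%:R : R[i]) = n%:R ^+ 2.
Proof. by rewrite -(rmorph_nat (real_complex R)) sqmod_real. Qed.

Lemma sqmod_prod (I : Type) (r : seq I) (P : pred I) (F : I -> R[i]) :
  sqmod (\prod_(i <- r | P i) F i) = \prod_(i <- r | P i) sqmod (F i).
Proof. exact: (big_morph _ sqmodM sqmod1). Qed.

(* 0 <= sum_{i,j} (F i - F j)^2 *)
Lemma sqr_sum_le (I : finType) (F : I -> R) :
  (\sum_i F i) ^+ 2 <= #|I|%:R * \sum_i F i ^+ 2.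
Proof.
have : 0 <= \sum_i \sum_j (F i - F j) ^+ 2.
  by do 2![apply: sumr_ge0 => ? _]; exact: sqr_ge0.
have -> : \sum_i \sum_j (F i - F j) ^+ 2 =
    2 * (#|I|%:R * \sum_i F i ^+ 2 - (\sum_i F i) ^+ 2).
  under eq_bigr do under eq_bigr do rewrite sqrrB.
  under eq_bigr => i _ do
    rewrite big_split sumrB /= sumr_const sumrMnl -mulr_sumr -[_ *+ #|_|]mulr_natl.
  rewrite big_split sumrB /= sumrMnl -mulr_suml -mulr_sumr sumr_const.
  rewrite -[_ *+ #|_|]mulr_natl.
  by set a := \sum_i _ ^+ 2; set b := \sum_i F i; ring.
by rewrite pmulr_rge0 // subr_ge0.
Qed.

Lemma sqmod_sum_le (I : finType) (F : I -> R[i]) :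
  sqmod (\sum_i F i) <= #|I|%:R * \sum_i sqmod (F i).
Proof.
have hRe : complex.Re (\sum_i F i) = \sum_i complex.Re (F i).
  by apply: (big_morph (@complex.Re R)) => // -[a b] [c d].
have hIm : complex.Im (\sum_i F i) = \sum_i complex.Im (F i).
  by apply: (big_morph (@complex.Im R)) => // -[a b] [c d].
by rewrite /sqmod hRe hIm big_split mulrDr lerD //= sqr_sum_le.
Qed.

End SquaredModulus.

Lemma sum_unit (V : nmodType) (F : unit -> V) : \sum_i F i = F tt.
Proof. by rewrite (bigD1 tt) //= big1 ?addr0 // => -[]. Qed.

Section Kraus.
Context {R : realType}.
Implicit Types X Y Z U : finType.

(** Indexing by finite types puts tensor powers on functions [{ffun I -> X}], so that regrouping
    factors needs no casts between dimensions. *)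
Record kraus X Y := Kraus { kidx : finType; kop : kidx -> Y -> X -> R[i] }.
Arguments kop {X Y} k _ _ _.

(* [choi K] determines the completely positive map of [K] independently of the choice
   of Kraus operators. *)
Definition choi X Y (K : kraus X Y) y x y' x' : R[i] :=
  \sum_j kop K j y x * conjc (kop K j y' x').

Definition tp X Y (K : kraus X Y) : Prop :=
  forall x x', \sum_y choi K y x y x' = (x == x')%:R.

Definition fid X (K : kraus X X) : R :=
  (\sum_j sqmod (\sum_x kop K j x x)) / #|X|%:R ^+ 2.

Definition kraus_comp X Y Z (K2 : kraus Y Z) (K1 : kraus X Y) : kraus X Z :=
  Kraus (fun (j : kidx K2 * kidx K1) z x =>
    \sum_y kop K2 j.1 z y * kop K1 j.2 y x).

Definition kraus_tens (I : finType) X Y (K : kraus X Y) :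
    kraus {ffun I -> X} {ffun I -> Y} :=
  Kraus (fun (j : {ffun I -> kidx K}) (y : {ffun I -> Y}) (x : {ffun I -> X}) =>
    \prod_i kop K (j i) (y i) (x i)).

Definition kraus_prod X Y X' Y' (K : kraus X Y) (K' : kraus X' Y') :
    kraus (X * X')%type (Y * Y')%type :=
  Kraus (fun (j : kidx K * kidx K') y x =>
    kop K j.1 y.1 x.1 * kop K' j.2 y.2 x.2).

(** Expanding the squared trace as a double sum and summing over [j] first leaves only Choi
    entries. *)
Lemma fid_choi X (K : kraus X X) :
  (fid K)%:C%C = (\sum_x \sum_x' choi K x x x' x') / #|X|%:R ^+ 2.
Proof.
rewrite /fid rmorphM fmorphV rmorphXn /= rmorph_nat; congr (_ / _).
rewrite rmorph_sum /=.
under eq_bigr => j _ do rewrite sqmod_complex rmorph_sum mulr_suml /=.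
rewrite exchange_big /=; apply: eq_bigr => x _.
under eq_bigr => j _ do rewrite mulr_sumr.
by rewrite exchange_big.
Qed.

Lemma eq_choi_fid X (K K' : kraus X X) :
  (forall y x y' x', choi K y x y' x' = choi K' y x y' x') -> fid K = fid K'.
Proof.
move=> h; apply: complexI; rewrite !fid_choi; congr (_ / _).
by apply: eq_bigr => x _; apply: eq_bigr => x' _; rewrite h.
Qed.

Lemma choi_comp X Y Z (K2 : kraus Y Z) (K1 : kraus X Y) z x z' x' :
  choi (kraus_comp K2 K1) z x z' x' =
  \sum_y \sum_y' choi K2 z y z' y' * choi K1 y x y' x'.
Proof.
rewrite /choi /=.
under eq_bigr => j _ do rewrite rmorph_sum mulr_suml /=.
rewrite exchange_big /=; apply: eq_bigr => y _.
under eq_bigr => j _ do rewrite mulr_sumr.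
rewrite exchange_big /=; apply: eq_bigr => y' _.
rewrite big_distrlr pair_big /=; apply: eq_bigr => -[j1 j2] _ /=.
by rewrite rmorphM mulrACA.
Qed.

Lemma eq_choi_comp X Y Z (K2 K2' : kraus Y Z) (K1 K1' : kraus X Y) :
  (forall z y z' y', choi K2 z y z' y' = choi K2' z y z' y') ->
  (forall y x y' x', choi K1 y x y' x' = choi K1' y x y' x') ->
  forall z x z' x', choi (kraus_comp K2 K1) z x z' x' = choi (kraus_comp K2' K1') z x z' x'.
Proof.
move=> h2 h1 z x z' x'; rewrite !choi_comp.
by apply: eq_bigr => y _; apply: eq_bigr => y' _; rewrite h2 h1.
Qed.

Lemma choi_compA X Y Z T (K3 : kraus Z T) (K2 : kraus Y Z) (K1 : kraus X Y) t x t' x' :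
  choi (kraus_comp K3 (kraus_comp K2 K1)) t x t' x' =
  choi (kraus_comp (kraus_comp K3 K2) K1) t x t' x'.
Proof.
rewrite !choi_comp.
under eq_bigr => z _ do under eq_bigr => z' _ do rewrite choi_comp.
under [RHS]eq_bigr => y _ do under eq_bigr => y' _ do rewrite choi_comp.
move: (choi K3) (choi K2) (choi K1) => f3 f2 f1; rewrite !pair_bigA /=.
under eq_bigr => p _ do rewrite pair_bigA mulr_sumr /=.
under [RHS]eq_bigr => p _ do rewrite pair_bigA mulr_suml /=.
rewrite exchange_big /=.
by apply: eq_bigr => p _; apply: eq_bigr => q _; rewrite mulrA.
Qed.

Lemma tp_comp X Y Z (K2 : kraus Y Z) (K1 : kraus X Y) :
  tp K2 -> tp K1 -> tp (kraus_comp K2 K1).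
Proof.
move=> h2 h1 x x'.
under eq_bigr => z _ do rewrite choi_comp pair_bigA /=.
rewrite exchange_big /= -(pair_bigA _ (fun y y' =>
  \sum_z choi K2 z y z y' * choi K1 y x y' x')) /=.
under eq_bigr => y _ do under eq_bigr => y' _ do rewrite -mulr_suml h2.
rewrite -h1; apply: eq_bigr => y _.
rewrite (bigD1 y) //= eqxx mul1r big1 ?addr0 // => y' hy'.
by rewrite eq_sym (negPf hy') mul0r.
Qed.

Lemma choi_tens (I : finType) X Y (K : kraus X Y) (y y' : {ffun I -> Y})
    (x x' : {ffun I -> X}) :
  choi (kraus_tens I K) y x y' x' = \prod_i choi K (y i) (x i) (y' i) (x' i).
Proof.
rewrite /choi bigA_distr_bigA /=; apply: eq_bigr => j _.
by rewrite rmorph_prod -big_split.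
Qed.

Lemma prod_eq_ffun (I : finType) X (x x' : {ffun I -> X}) :
  \prod_i ((x i == x' i)%:R : R[i]) = (x == x')%:R.
Proof.
have [->|/eqP h] := eqVneq x x'; first by rewrite big1 // => i _; rewrite eqxx.
have [i hi] : exists i, x i != x' i.
  by apply/existsP; rewrite -negb_forall; apply/negP => /forallP e; apply: h;
    apply/ffunP => i; exact/eqP.
by rewrite (bigD1 i) //= (negPf hi) mul0r.
Qed.

Lemma tp_tens (I : finType) X Y (K : kraus X Y) : tp K -> tp (kraus_tens I K).
Proof.
move=> h x x'; under eq_bigr => y _ do rewrite choi_tens.
rewrite -(bigA_distr_bigA (fun i y => choi K y (x i) y (x' i))).
by under eq_bigr => i _ do rewrite h; rewrite prod_eq_ffun.
Qed.

Lemma choi_tens_comp (I : finType) X Y Z (K2 : kraus Y Z) (K1 : kraus X Y)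
    z x z' x' :
  choi (kraus_tens I (kraus_comp K2 K1)) z x z' x' =
  choi (kraus_comp (kraus_tens I K2) (kraus_tens I K1)) z x z' x'.
Proof.
rewrite choi_tens choi_comp.
under eq_bigr => i _ do rewrite choi_comp.
rewrite bigA_distr_bigA /=; apply: eq_bigr => y _.
rewrite bigA_distr_bigA /=; apply: eq_bigr => y' _.
by rewrite !choi_tens -big_split.
Qed.

Lemma choi_prod X Y X' Y' (K : kraus X Y) (K' : kraus X' Y') y x y' x' :
  choi (kraus_prod K K') y x y' x' =
  choi K y.1 x.1 y'.1 x'.1 * choi K' y.2 x.2 y'.2 x'.2.
Proof.
rewrite /choi big_distrlr pair_big /=; apply: eq_bigr => -[j1 j2] _ /=.
by rewrite rmorphM mulrACA.
Qed.

Lemma tp_prod X Y X' Y' (K : kraus X Y) (K' : kraus X' Y') :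
  tp K -> tp K' -> tp (kraus_prod K K').
Proof.
move=> h h' [x1 x2] [x1' x2']; under eq_bigr => y _ do rewrite choi_prod.
rewrite -(pair_bigA _ (fun y1 y2 => choi K y1 x1 y1 x1' * choi K' y2 x2 y2 x2')) /=.
by rewrite -big_distrlr /= h h' xpair_eqE -natrM mulnb.
Qed.

Lemma tp_sqmod X Y (K : kraus X Y) x :
  tp K -> \sum_j \sum_y sqmod (kop K j y x) = 1.
Proof.
move=> h; apply: complexI; transitivity (\sum_y choi K y x y x); last by rewrite h eqxx.
rewrite exchange_big rmorph_sum; apply: eq_bigr => y _.
by rewrite rmorph_sum; apply: eq_bigr => j _; rewrite /= sqmod_complex.
Qed.

(** Cauchy-Schwarz bounds the squared trace by [#|X|] times the squared diagonal entries; each of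
    these is at most the squared norm of its column, and trace preservation makes those norms sum to
    1 over [j]. *)
Lemma fid_le1 X (K : kraus X X) : (0 < #|X|)%N -> tp K -> fid K <= 1.
Proof.
move=> X0 h; have X0' : 0 < #|X|%:R :> R by rewrite ltr0n.
rewrite /fid ler_pdivrMr ?exprn_gt0 // mul1r.
have -> : #|X|%:R ^+ 2 = \sum_j (#|X|%:R * \sum_x \sum_y sqmod (kop K j y x)).
  rewrite -mulr_sumr exchange_big /=.
  by under eq_bigr => x _ do rewrite tp_sqmod //; rewrite sumr_const expr2.
apply: ler_sum => j _; apply: le_trans (sqmod_sum_le _) _.
rewrite ler_pM2l //; apply: ler_sum => x _; rewrite (bigD1 x) //= lerDl.
by apply: sumr_ge0 => ? _; exact: sqmod_ge0.
Qed.

Definition has_code X Y (A : kraus X Y) (U : finType) (f : R) : Prop :=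
  exists (E : kraus U X) (D : kraus Y U),
    [/\ tp E, tp D & f <= fid (kraus_comp D (kraus_comp A E))].

Lemma has_code_le X Y (A : kraus X Y) U f f' :
  f' <= f -> has_code A U f -> has_code A U f'.
Proof.
by move=> hf [E [D [hE hD h]]]; exists E, D; split => //; exact: le_trans h.
Qed.

(** The maps [E] and [D] are absorbed into encoder and decoder. Associativity is used at the level
    of [choi], because the Kraus index types differ. *)
Lemma has_code_comp X Y X' Y' (A : kraus X Y) (E : kraus X' X) (D : kraus Y Y') U f :
  tp E -> tp D -> has_code (kraus_comp D (kraus_comp A E)) U f -> has_code A U f.
Proof.
move=> hE hD [E' [D' [hE' hD' hf]]].
exists (kraus_comp E E'), (kraus_comp D' D); split; try exact: tp_comp.
apply: le_trans hf _; rewrite le_eqVlt; apply/orP; left; apply/eqP.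
apply: eq_choi_fid => u v u' v'.
rewrite -choi_compA; apply: eq_choi_comp => {u v u' v'} // u v u' v'.
rewrite -choi_compA; apply: eq_choi_comp => {u v u' v'} // u v u' v'.
by rewrite choi_compA.
Qed.

Lemma has_code_tens (I : finType) X Y X' (A : kraus X Y) (E : kraus X' X)
    (D : kraus Y X') U f :
  tp E -> tp D -> has_code (kraus_tens I (kraus_comp D (kraus_comp A E))) U f ->
  has_code (kraus_tens I A) U f.
Proof.
move=> hE hD [E' [D' [hE' hD' hf]]].
apply: (has_code_comp (tp_tens (I := I) hE) (tp_tens (I := I) hD)).
exists E', D'; split => //; apply: le_trans hf _; rewrite le_eqVlt; apply/orP; left.
apply/eqP/eq_choi_fid; apply: eq_choi_comp => //; apply: eq_choi_comp => //.
move=> z x z' x'; rewrite choi_tens_comp; apply: eq_choi_comp => //.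
by move=> *; rewrite choi_tens_comp.
Qed.

Definition krelabel X Y (h : Y -> X) : kraus X Y :=
  Kraus (fun (_ : unit) y x => (x == h y)%:R).

Lemma choi_relabel X Y (h : Y -> X) y x y' x' :
  choi (krelabel h) y x y' x' = (x == h y)%:R * (x' == h y')%:R.
Proof. by rewrite /choi sum_unit /= conjc_nat. Qed.

Lemma tp_relabel X Y (h : Y -> X) : bijective h -> tp (krelabel h).
Proof.
case=> g hK gK x x'; under eq_bigr => y _ do rewrite choi_relabel.
rewrite (bigD1 (g x)) //= gK eqxx mul1r big1 ?addr0 1?eq_sym // => y hy.
by rewrite (_ : x == h y = false) ?mul0r //; apply: contraNF hy => /eqP ->; rewrite hK.
Qed.

Lemma has_code_relabel X Y X' Y' (A : kraus X Y) (A' : kraus X' Y')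
    (hx : X' -> X) (hy : Y' -> Y) U f :
  bijective hx -> bijective hy ->
  (forall y x y' x', choi A' y x y' x' = choi A (hy y) (hx x) (hy y') (hx x')) ->
  has_code A U f -> has_code A' U f.
Proof.
move=> [gx hxK gxK] [gy hyK gyK] hA [E [D [hE hD hf]]].
apply: (@has_code_comp _ _ _ _ _ (krelabel hx) (krelabel gy)).
- by apply: tp_relabel; exists gx.
- by apply: tp_relabel; exists hy.
exists E, D; split => //; apply: le_trans hf _; rewrite le_eqVlt; apply/orP; left.
apply/eqP/eq_choi_fid; apply: eq_choi_comp => //; apply: eq_choi_comp => //.
move=> y x y' x'; rewrite choi_comp (bigD1 (gy y)) //= (bigD1 (gy y')) //=.
rewrite big1 => [|z hz]; last by rewrite choi_relabel (negPf hz) mulr0 mul0r.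
rewrite big1 => [|z hz]; last first.
  by rewrite big1 // => z' _; rewrite choi_relabel (negPf hz) !mul0r.
rewrite !addr0 choi_relabel !eqxx !mul1r choi_comp.
rewrite (bigD1 (gx x)) //= (bigD1 (gx x')) //=.
rewrite big1 => [|z hz]; last first.
  rewrite choi_relabel (_ : x' == hx z = false) ?mulr0 //.
  by apply: contraNF hz => /eqP ->; rewrite hxK.
rewrite big1 => [|z hz]; last first.
  rewrite big1 // => z' _; rewrite choi_relabel (_ : x == hx z = false) ?mul0r ?mulr0 //.
  by apply: contraNF hz => /eqP ->; rewrite hxK.
by rewrite !addr0 choi_relabel !gxK !eqxx !mulr1 hA !gxK !gyK.
Qed.

Definition kprep X (x0 : X) : kraus unit X := Kraus (fun (_ : unit) x _ => (x == x0)%:R).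

(** The trace, whose Kraus operators are the basis bras. *)
Definition kdiscard Y : kraus Y unit := Kraus (fun (j : Y) _ y => (y == j)%:R).

Lemma tp_prep X (x0 : X) : tp (kprep x0).
Proof.
move=> [] []; rewrite /choi /=.
under eq_bigr => y _ do rewrite sum_unit /= conjc_nat.
by rewrite (bigD1 x0) //= eqxx mulr1 big1 ?addr0 // => y /negPf ->; rewrite mul0r.
Qed.

Lemma tp_discard Y : tp (kdiscard Y).
Proof.
move=> y y'; rewrite sum_unit /= /choi (bigD1 y) //= eqxx mul1r.
rewrite conjc_nat eq_sym big1 ?addr0 // => z /negPf hz.
by rewrite eq_sym hz mul0r.
Qed.

Lemma choi_comp_idl X Y (K : kraus X Y) y x y' x' :
  choi (kraus_comp (krelabel id) K) y x y' x' = choi K y x y' x'.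
Proof.
rewrite choi_comp (bigD1 y) //= (bigD1 y') //= choi_relabel !eqxx !mul1r.
rewrite big1 => [|z /negPf hz]; last by rewrite choi_relabel hz mulr0 mul0r.
rewrite big1 ?addr0 // => z /negPf hz.
by rewrite big1 // => z' _; rewrite choi_relabel hz !mul0r.
Qed.

Lemma choi_comp_idr X Y (K : kraus X Y) y x y' x' :
  choi (kraus_comp K (krelabel id)) y x y' x' = choi K y x y' x'.
Proof.
rewrite choi_comp (bigD1 x) //= (bigD1 x') //= choi_relabel !eqxx !mulr1.
rewrite big1 => [|z /negPf hz]; last by rewrite choi_relabel (eq_sym x') hz !mulr0.
rewrite big1 ?addr0 // => z /negPf hz.
by rewrite big1 // => z' _; rewrite choi_relabel (eq_sym x) hz mul0r mulr0.
Qed.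

Lemma choi_comp_prod X Y Z X' Y' Z' (K2 : kraus Y Z) (K1 : kraus X Y)
    (K2' : kraus Y' Z') (K1' : kraus X' Y') z x z' x' :
  choi (kraus_comp (kraus_prod K2 K2') (kraus_prod K1 K1')) z x z' x' =
  choi (kraus_prod (kraus_comp K2 K1) (kraus_comp K2' K1')) z x z' x'.
Proof.
rewrite choi_prod !choi_comp big_distrlr [RHS]pair_bigA /=; apply: eq_bigr => -[y1 y2] _.
rewrite big_distrlr [RHS]pair_bigA /=; apply: eq_bigr => -[y1' y2'] _.
by rewrite !choi_prod mulrACA.
Qed.

Lemma eq_choi_prod X Y X' Y' (K L : kraus X Y) (K' L' : kraus X' Y') :
  (forall y x y' x', choi K y x y' x' = choi L y x y' x') ->
  (forall y x y' x', choi K' y x y' x' = choi L' y x y' x') ->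
  forall y x y' x', choi (kraus_prod K K') y x y' x' = choi (kraus_prod L L') y x y' x'.
Proof. by move=> h h' y x y' x'; rewrite !choi_prod h h'. Qed.

Lemma has_code_eq_choi X Y (A A' : kraus X Y) U f :
  (forall y x y' x', choi A' y x y' x' = choi A y x y' x') ->
  has_code A U f -> has_code A' U f.
Proof.
by move=> h; apply: (@has_code_relabel _ _ _ _ _ _ id id) => //; exists id.
Qed.

(** The second factor is fed the fixed basis state [x0] and its output is traced out. As [B]
    preserves the trace, this loop [one] is the identity of a one-dimensional space. *)
Lemma has_code_pad X Y X' Y' (A : kraus X Y) (B : kraus X' Y') (x0 : X') U f :
  tp B -> has_code A U f -> has_code (kraus_prod A B) U f.
Proof.
move=> hB hA; have bid T : bijective (@id T) by exists id.
pose one := kraus_comp (kdiscard Y') (kraus_comp B (kprep x0)).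
have hone : tp one by do 2?[apply: tp_comp => //]; [exact: tp_discard|exact: tp_prep].
have h1 : has_code (kraus_prod A one) U f.
  apply: (has_code_relabel (hx := fst) (hy := fst)) hA.
  - by exists (fun x => (x, tt)) => // -[x []].
  - by exists (fun x => (x, tt)) => // -[x []].
  move=> [y []] [x []] [y' []] [x' []]; rewrite choi_prod /=.
  by have := hone tt tt; rewrite sum_unit /= => ->; rewrite mulr1.
apply: (@has_code_comp _ _ _ _ _ (kraus_prod (krelabel id) (kprep x0))
                                 (kraus_prod (krelabel id) (kdiscard Y'))).
- by apply: tp_prod; [exact: tp_relabel|exact: tp_prep].
- by apply: tp_prod; [exact: tp_relabel|exact: tp_discard].
apply: has_code_eq_choi h1 => y x y' x'.
rewrite (eq_choi_comp (fun _ _ _ _ => erefl) (@choi_comp_prod _ _ _ _ _ _ _ _ _ _)).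
rewrite choi_comp_prod; apply: eq_choi_prod => // {}y {}x {}y' {}x'.
by rewrite choi_comp_idl choi_comp_idr.
Qed.
End Kraus.

Arguments kop {R X Y} k _ _ _.

(** * Codes from families of isometries *)

Section Recovery.
Context {R : realType}.
Variables (H U T : finType) (Tp : pred T) (V : T -> H -> U -> R[i]) (u0 : U).
Hypothesis V_orth : forall t t' u u', Tp t -> Tp t' ->
  \sum_h conjc (V t h u) * V t' h u' = ((t == t') && (u == u'))%:R.

(** The projection onto the sum of the ranges of the [V t], which are mutually orthogonal by
    [V_orth]. *)
Let G h h' : R[i] := \sum_(t | Tp t) \sum_u V t h u * conjc (V t h' u).

(** The branch [inl t] undoes [V t]; the branches [inr] project onto the complement of all the
    ranges and reset to [u0]. *)
Definition krecover : kraus H U :=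
  Kraus (fun (j : T + H) u h =>
    match j with
    | inl t => if Tp t then conjc (V t h u) else 0
    | inr h' => (u == u0)%:R * ((h' == h)%:R - G h' h)
    end).

Let conjG h h' : conjc (G h h') = G h' h.
Proof.
rewrite /G rmorph_sum; apply: eq_bigr => t _; rewrite rmorph_sum /=.
by apply: eq_bigr => u _; rewrite rmorphM /= conjcK mulrC.
Qed.

Let G_idem h h' : \sum_k G h k * G k h' = G h h'.
Proof.
have E k : G h k * G k h' = \sum_(t | Tp t) \sum_u \sum_(t' | Tp t') \sum_u'
    V t h u * conjc (V t' h' u') * (conjc (V t k u) * V t' k u').
  rewrite /G big_distrl /=; apply: eq_bigr => t _; rewrite big_distrl /=.
  apply: eq_bigr => u _; rewrite big_distrr /=; apply: eq_bigr => t' _.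
  by rewrite big_distrr /=; apply: eq_bigr => u' _; ring.
under eq_bigr => k _ do rewrite E.
rewrite exchange_big /= {1}/G; apply: eq_bigr => t ht.
rewrite exchange_big /=; apply: eq_bigr => u _.
rewrite exchange_big (bigD1 t) //= [X in _ + X]big1 => [|t' /andP[ht' htt']]; last first.
  rewrite exchange_big big1 // => u' _; rewrite -mulr_sumr V_orth // eq_sym.
  by rewrite (negPf htt') mulr0.
rewrite addr0 exchange_big (bigD1 u) //= -mulr_sumr V_orth // !eqxx mulr1.
rewrite big1 ?addr0 // => u' hu'; rewrite -mulr_sumr V_orth //.
by rewrite eqxx eq_sym (negPf hu') mulr0.
Qed.

(** The two kinds of branches contribute [G] and the square of [1 - G], which is [1 - G] since [G]
    is idempotent. *)
Lemma tp_recover : tp krecover.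
Proof.
move=> y y'; rewrite /choi /=.
under eq_bigr => u _ do rewrite big_sumType /=.
rewrite big_split /= exchange_big /=.
have -> : \sum_t \sum_u (if Tp t then conjc (V t y u) else 0) *
    conjc (if Tp t then conjc (V t y' u) else 0) = G y' y.
  rewrite /G [RHS]big_mkcond; apply: eq_bigr => t _ /=.
  case: ifP => _; last by rewrite big1 // => u _; rewrite mul0r.
  by apply: eq_bigr => u _; rewrite conjcK mulrC.
rewrite (bigD1 u0) //= [X in _ + (_ + X)]big1 => [|u /negPf hu]; last first.
  by rewrite big1 // => h _; rewrite hu !mul0r.
rewrite eqxx addr0.
under eq_bigr => h _ do rewrite !mul1r rmorphB /= conjc_nat conjG mulrBl !mulrBr.
rewrite !(big_split, sumrN) /=.
have sum_delta z (F : H -> R[i]) : \sum_h (h == z)%:R * F h = F z.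
  rewrite (bigD1 z) //= eqxx mul1r big1 ?addr0 // => h /negPf ->.
  by rewrite mul0r.
rewrite !sum_delta.
under [X in _ + (_ - (X + _))]eq_bigr => h _ do rewrite mulrC.
rewrite sum_delta.
under [X in _ + (_ - (_ - X))]eq_bigr => h _ do rewrite mulrC.
by rewrite G_idem; ring.
Qed.

End Recovery.

Section IsometryCode.
Context {R : realType}.
Variables (H U S T : finType) (B : @kraus R H H).
Variables (Tp : pred T) (P : T -> H -> H -> R[i]) (W : S -> H -> U -> R[i]).
Variables (u0 : U) (s0 : S) (c : nat).

Hypothesis W_isometry : forall s u u',
  \sum_h conjc (W s h u) * W s h u' = (u == u')%:R.
Hypothesis PW_orth : forall s t t' u u', Tp t -> Tp t' ->
  \sum_h conjc (\sum_h' P t h h' * W s h' u) * (\sum_h' P t' h h' * W s h' u') =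
  ((t == t') && (u == u'))%:R.
(** The ranges of the isometries cover the space evenly, [c] times over: [c = 1] for an orthogonal
    decomposition, [c = #|U|] for the translates of a coordinate subspace. *)
Hypothesis W_resolution : forall h h',
  \sum_s \sum_u W s h u * conjc (W s h' u) = c%:R * (h == h')%:R.
Hypothesis card_resolution : (#|S| * #|U| = c * #|H|)%N.
Hypothesis c_gt0 : (0 < c)%N.

Let err (t : T) (j : kidx B) : R[i] :=
  \sum_h \sum_h' conjc (P t h h') * kop B j h h'.

(* Jensen's inequality in the form |E_s z_s|^2 <= E_s |z_s|^2, with z_s the
   trace of P_t^* B_j compressed to the range of W_s. *)
Lemma has_code_isometry :
  has_code B U (\sum_(t | Tp t) (\sum_j sqmod (err t j)) / #|H|%:R ^+ 2).
Proof.
pose V s t h u := \sum_h' P t h h' * W s h' u.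
pose E s : kraus U H := Kraus (fun (_ : unit) h u => W s h u).
pose D s := krecover Tp (V s) u0.
pose f := \sum_(t | Tp t) (\sum_j sqmod (err t j)) / #|H|%:R ^+ 2.
pose F s := fid (kraus_comp (D s) (kraus_comp B (E s))).
suff [s hs] : exists s, f <= F s.
  exists (E s), (D s); split => //.
    move=> u u'; rewrite /choi /=.
    under eq_bigr => h _ do rewrite sum_unit mulrC.
    by rewrite W_isometry eq_sym.
  by apply: tp_recover => *; exact: PW_orth.
pose tau s t j := \sum_u \sum_h conjc (V s t h u) * \sum_h' kop B j h h' * W s h' u.
(* Only the branches [inl t] of the recovery are kept; the others add nonnegative terms. *)
have F_ge s : \sum_(t | Tp t) (\sum_j sqmod (tau s t j)) / #|U|%:R ^+ 2 <= F s.
  rewrite /F /fid -mulr_suml ler_wpM2r ?invr_ge0 ?exprn_ge0 //.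
  rewrite -(pair_bigA _ (fun jd je => sqmod (\sum_x \sum_y kop (D s) jd x y *
     (\sum_z kop B je.1 y z * kop (E s) je.2 z x)))) /= big_sumType /=.
  rewrite ler_wpDr ?sumr_ge0 // => [h _|].
    by apply: sumr_ge0 => j _; exact: sqmod_ge0.
  rewrite big_mkcond; apply: ler_sum => t _.
  case: ifP => _; last by apply: sumr_ge0 => j _; exact: sqmod_ge0.
  rewrite -(pair_bigA _ (fun j (_ : unit) => sqmod (\sum_x \sum_y conjc (V s t y x) *
     (\sum_z kop B j y z * W s z x)))) /=.
  by apply: ler_sum => j _; rewrite sum_unit.
(* By [W_resolution], summing over [s] replaces the compression to the code by [c] times the
   identity. *)
have sum_tau t j : \sum_s tau s t j = c%:R * err t j.
  rewrite /tau /err /V.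
  transitivity (\sum_s \sum_u \sum_h \sum_h' \sum_k
      conjc (P t h k) * kop B j h h' * (W s h' u * conjc (W s k u))).
    apply: eq_bigr => s _; apply: eq_bigr => u _; apply: eq_bigr => h _.
    rewrite mulr_sumr; apply: eq_bigr => h' _; rewrite rmorph_sum mulr_suml.
    by apply: eq_bigr => k _; rewrite rmorphM /=; ring.
  rewrite pair_bigA exchange_big mulr_sumr; apply: eq_bigr => h _ /=.
  rewrite exchange_big mulr_sumr; apply: eq_bigr => h' _ /=.
  rewrite exchange_big /=.
  rewrite (bigD1 h') //= -mulr_sumr -(pair_bigA _ (fun s u => W s h' u * conjc (W s h' u))).
  rewrite W_resolution eqxx big1 => [|k /negPf hk]; first by rewrite addr0 mulr1; ring.
  rewrite -mulr_sumr -(pair_bigA _ (fun s u => W s h' u * conjc (W s k u))).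
  by rewrite W_resolution eq_sym hk !mulr0.
have S0 : 0 < #|S|%:R :> R by rewrite ltr0n; apply/card_gt0P; exists s0.
have U0 : 0 < #|U|%:R :> R by rewrite ltr0n; apply/card_gt0P; exists u0.
have H0 : 0 < #|H|%:R :> R.
  have := card_resolution; have : (0 < #|S| * #|U|)%N by rewrite muln_gt0 -!(ltr0n R) S0.
  by rewrite ltr0n; case: #|H| => // + e; rewrite e muln0.
have c0 : 0 < c%:R :> R by rewrite ltr0n.
have jensen t j : sqmod (err t j) / #|H|%:R ^+ 2 * #|S|%:R <=
    \sum_s sqmod (tau s t j) / #|U|%:R ^+ 2.
  rewrite -mulr_suml ler_pdivlMr ?exprn_gt0 //.
  rewrite -(ler_pM2l S0); apply: le_trans (sqmod_sum_le (fun s => tau s t j)).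
  rewrite sum_tau sqmodM sqmod_nat.
  have e : #|S|%:R * #|U|%:R = c%:R * #|H|%:R :> R by rewrite -!natrM card_resolution.
  rewrite (_ : #|S|%:R * _ = (#|S|%:R * #|U|%:R) ^+ 2 / #|H|%:R ^+ 2 * sqmod (err t j)).
    by rewrite e exprMn mulfK // expf_neq0 // gt_eqF.
  by ring.
have avg : f * #|S|%:R <= \sum_s F s.
  apply: le_trans (ler_sum _ (fun s _ => F_ge s)).
  rewrite exchange_big /f mulr_suml; apply: ler_sum => t _.
  under [leRHS]eq_bigr => s _ do rewrite mulr_suml.
  rewrite exchange_big !mulr_suml; apply: ler_sum => j _; exact: jensen.
apply: contrapT => /forallNP h.
suff : \sum_s F s < f * #|S|%:R by rewrite ltNge avg.
rewrite mulr_natr -sumr_const; apply: ltr_sum => [|s _].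
  by apply/hasP; exists s0; rewrite ?mem_index_enum.
by rewrite ltNge; apply/negP.
Qed.
End IsometryCode.

Section Subcode.
Context {R : realType}.

(* Averaging over the translates of a set of [#|U|] basis vectors. *)
Lemma has_code_sub (K : nat) (B : @kraus R 'I_K.+1 'I_K.+1) (U : finType) :
  (0 < #|U|)%N -> (#|U| <= K.+1)%N -> has_code B U (fid B).
Proof.
move=> U0 UK; have [u0 _] := card_gt0P U0.
pose g (u : U) : 'I_K.+1 := widen_ord UK (enum_rank u).
have g_inj : injective g.
  move=> u u' e; apply: enum_rank_inj; apply: val_inj.
  exact: (congr1 (@nat_of_ord _) e).
(* Addition in ['I_K.+1] is cyclic, so over all shifts [s] each basis vector is covered [#|U|]
   times. The only error to correct is the identity [P], whose weight in [B] is [fid B]. *)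
pose W (s h : 'I_K.+1) u : R[i] := (h == g u + s)%:R.
pose P (_ : unit) (h h' : 'I_K.+1) : R[i] := (h == h')%:R.
have W_iso s u u' : \sum_h conjc (W s h u) * W s h u' = (u == u')%:R.
  rewrite (bigD1 (g u + s)) //= /W conjc_nat eqxx mul1r big1 => [|h /negPf hh].
    by rewrite addr0 (inj_eq (addIr s)) (inj_eq g_inj).
  by rewrite conjc_nat hh mul0r.
have PW s h u : \sum_h' P tt h h' * W s h' u = W s h u.
  rewrite (bigD1 h) //= {1}/P eqxx mul1r big1 ?addr0 // => h' /negPf hh.
  by rewrite /P eq_sym hh mul0r.
have := @has_code_isometry R 'I_K.+1 U 'I_K.+1 unit B xpredT P W u0 ord0 #|U| W_iso.
rewrite sum_unit.
have -> : (\sum_j sqmod (\sum_h \sum_h' conjc (P tt h h') * kop B j h h')) /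
    #|'I_K.+1|%:R ^+ 2 = fid B.
  congr (_ / _); apply: eq_bigr => j _; congr sqmod; apply: eq_bigr => h _.
  rewrite (bigD1 h) //= /P eqxx conjc1 mul1r big1 ?addr0 // => h' /negPf hh.
  by rewrite eq_sym hh conjc0 mul0r.
apply => //.
- move=> s [] [] u u' _ _; rewrite /= -(W_iso s); apply: eq_bigr => h _.
  by rewrite !PW.
- move=> h h'; rewrite exchange_big /=.
  have E u : \sum_s W s h u * conjc (W s h' u) = (h == h')%:R.
    have hg : g u + (h - g u) = h by rewrite addrC subrK.
    rewrite (bigD1 (h - g u)) //= /W hg eqxx mul1r big1 => [|s hs].
      by rewrite addr0 conjc_nat eq_sym.
    rewrite (_ : h == g u + s = false) ?mul0r //.
    by apply: contraNF hs => /eqP ->; rewrite [g u + s]addrC addrK.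
  by under eq_bigr => u _ do rewrite E; rewrite sumr_const mulr_natl.
- by rewrite mulnC.
Qed.
End Subcode.

(** * Binary CSS codes *)

Section BinaryCodes.
Local Notation F2 := 'F_2.

(** Union bound: the bad sets together fill at most half of [T]. *)
Lemma exists_avoiding (T I : finType) (S : {set I}) (bad : I -> {set T}) :
  (0 < #|T|)%N -> (forall i, i \in S -> (2 * #|S| * #|bad i| <= #|T|)%N) ->
  exists t, forall i, i \in S -> t \notin bad i.
Proof.
move=> T0 hbad.
have hU : (#|\bigcup_(i in S) bad i| <= \sum_(i in S) #|bad i|)%N.
  elim/big_rec2: _ => [|i m A _ hm]; first by rewrite cards0.
  by rewrite (leq_trans (leq_card_setU _ _).1) // leq_add2l.
have lt : (#|\bigcup_(i in S) bad i| < #|T|)%N.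
  apply: leq_ltn_trans hU _.
  have [S0|S0] := posnP #|S|; first by rewrite (cards0_eq S0) big_set0.
  rewrite -(@ltn_pmul2l (2 * #|S|)) ?muln_gt0 // big_distrr /=.
  apply: (@leq_ltn_trans (\sum_(i in S) #|T|)); first exact: leq_sum.
  by rewrite sum_nat_const ltn_pmul2r // ltn_Pmull.
have [t ht] : exists t, t \notin \bigcup_(i in S) bad i.
  apply/existsP; rewrite -negb_forall; apply: contraL lt => /forallP h.
  rewrite -leqNgt; apply/subset_leq_card/fintype.subsetP => t _; exact: h.
exists t => i hi; apply: contra ht => h; apply/bigcupP; by exists i.
Qed.

(** As [x] is nonzero, [x *m Z] can be any prescribed vector, and translation by such a [Z] injects
    one fibre of the map sending [A] to [x *m A] into any other; so the [2 ^ a] fibres have equal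
    size. *)
Lemma card_row_fiber (p a : nat) (x : 'rV[F2]_p) (c : 'rV[F2]_a) : x != 0 ->
  (2 ^ a * #|[set A : 'M[F2]_(p, a) | x *m A == c]| <= #|{: 'M[F2]_(p, a)}|)%N.
Proof.
move=> /rV0Pn[i xi0].
pose fib c' := [set A : 'M[F2]_(p, a) | x *m A == c'].
have le_fib c' : (#|fib c| <= #|fib c'|)%N.
  pose Z := (x 0 i)^-1 *: (delta_mx i 0 *m (c' - c)) : 'M[F2]_(p, a).
  have xZ : x *m Z = c' - c.
    rewrite -scalemxAr mulmxA -colE (_ : col i x = (x 0 i)%:M).
      by rewrite mul_scalar_mx scalerA mulVf // scale1r.
    by apply/rowP => j; rewrite !mxE !ord1 eqxx mulr1n.
  rewrite -(card_imset (fib c) (addIr Z)); apply/subset_leq_card/fintype.subsetP => B.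
  by case/imsetP => A; rewrite !inE => /eqP hA ->; rewrite mulmxDr hA xZ addrC subrK.
have tot : \sum_(c' : 'rV[F2]_a) #|fib c'| = #|{: 'M[F2]_(p, a)}|.
  rewrite -sum1_card (partition_big (fun A => x *m A) xpredT) //=.
  by apply: eq_bigr => c' _; rewrite -sum1_card; apply: eq_bigl => A; rewrite inE.
have -> : (2 ^ a = #|{: 'rV[F2]_a}|)%N by rewrite card_mx mul1n card_ord.
by rewrite -tot -sum_nat_const; apply: leq_sum => c' _; exact: le_fib.
Qed.

Lemma hsubmx_eq0 (m n : nat) (x : 'rV[F2]_(m + n)) :
  lsubmx x = 0 -> rsubmx x = 0 -> x = 0.
Proof. by move=> hl hr; rewrite -[x]hsubmxK hl hr row_mx0. Qed.

Definition dotv n (x y : 'rV[F2]_n) : F2 := (x *m y^T) 0 0.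

Lemma dotvDl n (x x' y : 'rV[F2]_n) : dotv (x + x') y = dotv x y + dotv x' y.
Proof. by rewrite /dotv mulmxDl mxE. Qed.

Lemma dotvC n (x y : 'rV[F2]_n) : dotv x y = dotv y x.
Proof. by rewrite /dotv -[in LHS](trmxK x) -trmx_mul mxE. Qed.

Lemma dotvDr n (x y y' : 'rV[F2]_n) : dotv x (y + y') = dotv x y + dotv x y'.
Proof. by rewrite !(dotvC x) dotvDl. Qed.

Lemma dotv0 n (x : 'rV[F2]_n) : dotv x 0 = 0.
Proof. by rewrite /dotv trmx0 mulmx0 mxE. Qed.

Lemma dotvE n (x y : 'rV[F2]_n) : dotv x y = \sum_i x 0 i * y 0 i.
Proof. by rewrite /dotv mxE; apply: eq_bigr => i _; rewrite mxE. Qed.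

Lemma dotv_neq0 n (x : 'rV[F2]_n) : x != 0 -> exists y, dotv x y != 0.
Proof.
move=> /rV0Pn[i xi0]; exists (delta_mx 0 i).
by rewrite /dotv trmx_delta -colE mxE.
Qed.

(** Here [v] is the bit-flip syndrome, [u] the logical label and [w] the position in a coset of
    [ker u :&: ker v], the space of X-checks. First [ker v] is chosen as the graph of a matrix [A],
    then the X-checks inside it. For each condition a vector of [S] spoils at most a fraction
    [2 ^- a] or [2 ^- b] of the choices; the factor 4 makes room for two conditions on [A]. *)
Lemma css_code_exists (k b a : nat) (S : {set 'rV[F2]_(k + b + a)}) :
  (4 * #|S| <= 2 ^ a)%N -> (4 * #|S| <= 2 ^ b)%N ->
  exists (u : 'rV[F2]_(k + b + a) -> 'rV[F2]_k)
         (w : 'rV[F2]_(k + b + a) -> 'rV[F2]_b)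
         (v : 'rV[F2]_(k + b + a) -> 'rV[F2]_a),
  [/\ {morph u : x y / x + y}, {morph v : x y / x + y},
      injective (fun y => (u y, w y, v y)),
      forall x, x \in S -> x != 0 -> v x != 0 &
      forall z, z \in S -> z != 0 ->
        exists y, [/\ u y = 0, v y = 0 & dotv z y != 0]].
Proof.
move=> ha hb.
pose bad1 (x : 'rV[F2]_(k + b + a)) : {set 'M[F2]_(k + b, a)} :=
  [set A | (lsubmx x != 0) && (lsubmx x *m A == rsubmx x)].
(* These [A] make [z] orthogonal to the whole graph of [A]. If [rsubmx z = 0], that orthogonality
   already forces [z = 0], so no [A] has to be excluded. *)
pose bad2 (z : 'rV[F2]_(k + b + a)) : {set 'M[F2]_(k + b, a)} :=
  [set A | (rsubmx z != 0) && (rsubmx z *m A^T == - lsubmx z)].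
have bad1_le x : (2 ^ a * #|bad1 x| <= #|{: 'M[F2]_(k + b, a)}|)%N.
  rewrite /bad1; have [->|x0] := eqVneq (lsubmx x) 0.
    by rewrite (_ : [set _ | _] = finset.set0) ?cards0 ?muln0 //; apply/setP => A; rewrite !inE.
  exact: card_row_fiber.
have bad2_le z : (2 ^ b * #|bad2 z| <= #|{: 'M[F2]_(k + b, a)}|)%N.
  rewrite /bad2; have [->|z0] := eqVneq (rsubmx z) 0.
    by rewrite (_ : [set _ | _] = finset.set0) ?cards0 ?muln0 //; apply/setP => A; rewrite !inE.
  apply: (@leq_trans (2 ^ (k + b) * #|[set A : 'M[F2]_(k + b, a) |
      true && (rsubmx z *m A^T == - lsubmx z)]|)).
    by rewrite leq_mul2r leq_exp2l ?leq_addl ?orbT.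
  rewrite -(card_imset _ (@trmx_inj F2 (k + b) a)).
  apply: leq_trans (_ : (#|{: 'M[F2]_(a, k + b)}| <= _)%N); last by rewrite !card_mx mulnC.
  apply: leq_trans (card_row_fiber (- lsubmx z) z0); rewrite leq_mul2l; apply/orP; right.
  by apply/subset_leq_card/fintype.subsetP => M /imsetP[A]; rewrite !inE => h ->.
have [||A hA] := @exists_avoiding _ _ S (fun x => bad1 x :|: bad2 x).
- by apply/card_gt0P; exists 0.
- move=> x _; rewrite -(@leq_pmul2l 2) //.
  apply: (@leq_trans (4 * #|S| * (#|bad1 x| + #|bad2 x|))).
    by rewrite !mulnA leq_mul2l (leq_card_setU _ _).1 orbT.
  rewrite mulnDr mul2n -addnn leq_add //.
    by apply: leq_trans (bad1_le x); rewrite leq_mul2r ha orbT.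
  by apply: leq_trans (bad2_le x); rewrite leq_mul2r hb orbT.
(* [q z] represents the functional [dotv z] on the graph of [A]; [bad3 z] contains the choices for
   which it would vanish on all X-checks and leave the phase error [z] undetected. *)
pose q (z : 'rV[F2]_(k + b + a)) := lsubmx z + rsubmx z *m A^T.
pose bad3 z : {set 'M[F2]_(k, b)} :=
  [set B | (lsubmx (q z) != 0) && (lsubmx (q z) *m B == - rsubmx (q z))].
have [||Bt hB] := @exists_avoiding _ _ S bad3.
- by apply/card_gt0P; exists 0.
- move=> z _; apply: (@leq_trans (2 ^ b * #|bad3 z|)).
    rewrite leq_mul2r; apply/orP; right; apply: leq_trans hb.
    by rewrite leq_mul2r orbT.
  rewrite /bad3; have [->|z0] := eqVneq (lsubmx (q z)) 0.
    by rewrite (_ : [set _ | _] = finset.set0) ?cards0 ?muln0 //; apply/setP => B; rewrite !inE.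
  exact: card_row_fiber.
(* The Z-checks are the columns of [-A; 1], giving the bit-flip syndrome [v]; the
   X-checks are the rows of (Bt^T, 1) * (1, A), which span [ker u :&: ker v]. *)
pose w (y : 'rV[F2]_(k + b + a)) := rsubmx (lsubmx y).
pose u (y : 'rV[F2]_(k + b + a)) := lsubmx (lsubmx y) - w y *m Bt^T.
pose v (y : 'rV[F2]_(k + b + a)) := rsubmx y - lsubmx y *m A.
exists u, w, v; split.
- by move=> x y; rewrite /u /w !linearD /= mulmxDl; rewrite opprD addrACA.
- by move=> x y; rewrite /v !linearD /= mulmxDl; rewrite opprD addrACA.
- move=> x y [+ hw +]; rewrite /u /v hw => /addIr hu.
  have hl : lsubmx x = lsubmx y by rewrite -[LHS]hsubmxK hu [rsubmx _]hw hsubmxK.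
  by rewrite hl => /addIr hr; rewrite -[x]hsubmxK hl hr hsubmxK.
- move=> x xS x0; apply/negP => /eqP vx0.
  have e : lsubmx x *m A = rsubmx x by apply/esym/eqP; rewrite -subr_eq0 -[X in X == 0]/(v x) vx0.
  have := hA x xS; rewrite !inE e eqxx andbT negb_or negbK => /andP[/eqP l0 _].
  by move: x0; rewrite (hsubmx_eq0 l0) ?eqxx // -e l0 mul0mx.
move=> z zS z0.
have q0 : q z != 0.
  apply/negP => /eqP qz0; have := hA z zS; rewrite !inE negb_or => /andP[_].
  rewrite -addr_eq0 addrC -/(q z) qz0 eqxx andbT negbK => /eqP r0.
  move: qz0 z0; rewrite /q r0 mul0mx addr0 => l0.
  by rewrite (hsubmx_eq0 l0 r0) eqxx.
have s0 : rsubmx (q z) + lsubmx (q z) *m Bt != 0.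
  apply/negP => /eqP s0; have := hB z zS; rewrite !inE.
  rewrite -addr_eq0 addrC s0 eqxx andbT negbK => /eqP l0.
  move: s0 q0; rewrite l0 mul0mx addr0 => r0.
  by rewrite (hsubmx_eq0 l0 r0) eqxx.
have [w0 hw0] := dotv_neq0 s0.
pose y1 : 'rV[F2]_(k + b) := row_mx (w0 *m Bt^T) w0.
exists (row_mx y1 (y1 *m A)); rewrite /u /v /w !(row_mxKl, row_mxKr) !subrr; split => //.
rewrite (_ : dotv _ _ = dotv (rsubmx (q z) + lsubmx (q z) *m Bt) w0) //.
rewrite /dotv; congr (fun_of_matrix _ 0 0).
rewrite -[z in LHS]hsubmxK tr_row_mx mul_row_col trmx_mul mulmxA -mulmxDl -/(q z).
rewrite -[q z in LHS]hsubmxK tr_row_mx mul_row_col trmx_mul trmxK mulmxA.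
by rewrite -mulmxDl addrC.
Qed.

End BinaryCodes.

(** * Characters of binary vector spaces *)

Section Characters.
Context {R : realType}.
Local Notation F2 := 'F_2.

Definition chi (a : F2) : R[i] := (-1) ^+ (a : nat).

Lemma chiD a b : chi (a + b) = chi a * chi b.
Proof.
case: a => -[|[|//]] ha; case: b => -[|[|//]] hb;
by rewrite /chi /= ?expr0 ?expr1 ?mulr1 ?mul1r ?mulrNN ?mulr1.
Qed.

Lemma chi0 : chi 0 = 1. Proof. by []. Qed.

Lemma chi_sqr a : chi a * chi a = 1.
Proof. by rewrite /chi -expr2 sqrr_sign. Qed.

Lemma chi_neq0 a : a != 0 -> chi a = -1.
Proof. by case: a => -[|[|//]]. Qed.

Lemma conj_chi a : conjc (chi a) = chi a.
Proof. by rewrite /chi rmorphXn rmorphN1. Qed.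

Lemma chi_sum (I : finType) (F : I -> F2) : chi (\sum_i F i) = \prod_i chi (F i).
Proof. exact: (big_morph chi chiD chi0). Qed.

(** Reindexing by [h] turns the sum into its own negative. *)
Lemma sum_antisym (I : finType) (P : pred I) (h : I -> I) (F : I -> R[i]) :
  injective h -> (forall i, P (h i) = P i) -> (forall i, P i -> F (h i) = - F i) ->
  \sum_(i | P i) F i = 0.
Proof.
move=> h_inj hP hF; suff /eqP : (\sum_(i | P i) F i) *+ 2 = 0.
  by rewrite mulrn_eq0 /= => /eqP.
rewrite mulr2n {1}(reindex_inj h_inj) /= (eq_bigl _ _ hP) -big_split big1 //=.
by move=> i hi; rewrite hF // addNr.
Qed.

Lemma sum_chi_dotv n (y : 'rV[F2]_n) :
  \sum_z chi (dotv z y) = (2 ^+ n) * (y == 0)%:R.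
Proof.
have [->|y0] := eqVneq y 0.
  under eq_bigr => z _ do rewrite dotv0 chi0.
  by rewrite sumr_const card_mx mul1n card_ord mulr1 natrX.
have [z0 hz0] := dotv_neq0 y0.
rewrite mulr0 (sum_antisym (h := fun z => z + z0)) //; first exact: addIr.
by move=> z _; rewrite dotvDl chiD dotvC (dotvC z0) (chi_neq0 hz0) mulrN1.
Qed.

Lemma addF2_eq0 n (x y : 'rV[F2]_n) : (x + y == 0) = (x == y).
Proof.
suff {1}-> : y = - y by rewrite subr_eq0.
apply/rowP => i; rewrite !mxE; case: (y 0 i) => -[|[|//]] hy; exact: val_inj.
Qed.

End Characters.

(** * Correction of Pauli errors by a CSS code *)

Section CSS.
Context {R : realType}.
Local Notation F2 := 'F_2.
Variables (H : finZmodType) (B : @kraus R H H) (dot : H -> H -> F2).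
Variables (k b a : nat).
Variables (u : H -> 'rV[F2]_k) (w : H -> 'rV[F2]_b) (v : H -> 'rV[F2]_a).
Variables (T : finType) (Tp : pred T) (xp zp : T -> H).

Hypothesis H_char2 : forall h : H, h + h = 0.
Hypothesis dotDl : forall x y z, dot (x + y) z = dot x z + dot y z.
Hypothesis dotDr : forall x y z, dot x (y + z) = dot x y + dot x z.
Hypothesis uD : {morph u : x y / x + y}.
Hypothesis vD : {morph v : x y / x + y}.
Hypothesis uwv_inj : injective (fun y => (u y, w y, v y)).
Hypothesis card_H : #|H| = (2 ^ (k + b + a))%N.
Hypothesis xz_inj : injective (fun t => (xp t, zp t)).
Hypothesis detect_x : forall t t', Tp t -> Tp t' -> xp t != xp t' -> v (xp t + xp t') != 0.
Hypothesis detect_z : forall t t', Tp t -> Tp t' -> zp t != zp t' ->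
  exists y, [/\ u y = 0, v y = 0 & dot (zp t + zp t') y != 0].

(** The entries of [X^x Z^z]: phase flips by [z], then bit flips by [x]. *)
Definition pauli (x z h h' : H) : R[i] := (h == h' + x)%:R * chi (dot z h').

Let al : R := (Num.sqrt (2 ^+ b))^-1.
Let al2 : (al%:C%C * al%:C%C) = (2 ^- b) :> R[i].
Proof.
rewrite -rmorphM /= /al -expr2 exprVn sqr_sqrtr ?exprn_ge0 //.
by rewrite fmorphV rmorphXn /= rmorph_nat.
Qed.

(** Codeword [c] for the phase syndrome [s.1] and the bit-flip syndrome [s.2]: the superposition of
    a coset of [ker u :&: ker v], with signs given by the character [s.1] of the coordinate [w]. The
    coset has [2 ^ b] elements, whence the factor [al]. *)
Let W (s : 'rV[F2]_b * 'rV[F2]_a) (h : H) (c : 'rV[F2]_k) : R[i] :=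
  al%:C%C * chi (dotv s.1 (w h)) * ((u h == c) && (v h == s.2))%:R.

Let conjW s h c : conjc (W s h c) = W s h c.
Proof. by rewrite /W !rmorphM /= conj_chi rmorph_nat oppr0. Qed.

Let pauliW x z s h c : \sum_h' pauli x z h h' * W s h' c =
  chi (dot z (h + x)) * W s (h + x) c.
Proof.
rewrite (bigD1 (h + x)) //= big1 => [|h' hh'].
  by rewrite addr0 /pauli -addrA H_char2 addr0 eqxx mul1r.
rewrite /pauli (_ : h == h' + x = false) ?mul0r //; apply: contraNF hh' => /eqP ->.
by rewrite -addrA H_char2 addr0.
Qed.

Let uwv_bij : bijective (fun y => (u y, w y, v y)).
Proof.
apply: inj_card_bij => //.
by rewrite !card_prod !card_mx !card_ord !mul1n card_H !expnD.
Qed.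

Let fiber_sum (c : 'rV[F2]_k) (d : 'rV[F2]_a) :
  \sum_h ((u h == c) && (v h == d))%:R = (2 ^+ b : R[i]).
Proof.
have [g fK gK] := uwv_bij.
transitivity (#|[set h | (u h == c) && (v h == d)]|%:R : R[i]).
  rewrite -sum1_card natr_sum [RHS]big_mkcond; apply: eq_bigr => h _.
  by rewrite inE; case: ifP.
have gE p q r : (u (g (p, q, r)) = p) * (v (g (p, q, r)) = r).
  by case: (gK (p, q, r)) => -> _ ->.
rewrite (_ : [set _ | _] = [set g (c, q, d) | q in [set: 'rV[F2]_b]]).
  rewrite card_imset ?cardsT ?card_mx ?card_ord ?mul1n ?natrX // => q q'.
  by move=> /(can_inj gK) [].
apply/setP => h; rewrite !inE; apply/andP/imsetP => [[/eqP <- /eqP <-]|[q _ ->]].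
  by exists (w h); rewrite ?inE // fK.
by rewrite !gE !eqxx.
Qed.

(** Distinct errors in [Tp] move each code sector to orthogonal spaces, and the sectors of all
    syndromes resolve the identity once; so [has_code_isometry] applies with [c = 1]. *)
Lemma has_code_css : has_code B 'rV[F2]_k (\sum_(t | Tp t)
  (\sum_j sqmod (\sum_h \sum_h' conjc (pauli (xp t) (zp t) h h') * kop B j h h')) /
  #|H|%:R ^+ 2).
Proof.
have orth s t t' c c' : Tp t -> Tp t' ->
    \sum_h conjc (chi (dot (zp t) (h + xp t)) * W s (h + xp t) c) *
      (chi (dot (zp t') (h + xp t')) * W s (h + xp t') c') =
    ((t == t') && (c == c'))%:R.
  (* Different bit-flip parts give disjoint supports: two words of syndrome [s.2] have a sum in
     [ker v], against [detect_x]. *)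
  move=> ht ht'; have [ex|nx] := eqVneq (xp t) (xp t'); last first.
    rewrite (_ : t == t' = false) /=; last by apply: contraNF nx => /eqP ->.
    rewrite big1 // => h _; rewrite rmorphM /= conj_chi conjW /W.
    have [/eqP e1|] := boolP (v (h + xp t) == s.2); last by rewrite andbF !mulr0 mul0r.
    have [/eqP e2|] := boolP (v (h + xp t') == s.2); last by rewrite andbF !mulr0.
    have := detect_x ht ht' nx; rewrite (_ : xp t + xp t' = (h + xp t) + (h + xp t')).
      by rewrite vD e1 e2 addF2_eq0 eqxx.
    by rewrite addrACA H_char2 add0r.
  rewrite -ex (reindex_inj (addIr (xp t))) /=.
  under eq_bigr => h _.
    rewrite -addrA H_char2 addr0 rmorphM /= conj_chi conjW.
    rewrite (_ : _ * _ = 2 ^- b * (chi (dot (zp t + zp t') h) *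
      ((c == c')%:R * ((u h == c) && (v h == s.2))%:R))); last first.
      rewrite dotDl chiD -al2 /W.
      transitivity (al%:C%C * al%:C%C * (chi (dot (zp t) h) * chi (dot (zp t') h) *
        (((u h == c) && (v h == s.2))%:R * ((u h == c') && (v h == s.2))%:R)) *
        (chi (dotv s.1 (w h)) * chi (dotv s.1 (w h)))); first by ring.
      rewrite chi_sqr mulr1; congr (_ * (_ * _)); rewrite -!natrM !mulnb; congr (nat_of_bool _)%:R.
      have [<-|] := eqVneq (u h) c; last by rewrite andbF.
      by case: (v h == s.2); rewrite ?andbT ?andbF.
    over.
  rewrite -mulr_sumr.
  have [_|nc] := eqVneq c c'; last first.
    by rewrite andbF big1 ?mulr0 // => h _; rewrite mul0r mulr0.
  rewrite andbT; under eq_bigr => h _ do rewrite mul1r.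
  have [ez|nz] := eqVneq (zp t) (zp t').
    have -> : t == t' by apply/eqP/xz_inj; rewrite ex ez.
    under eq_bigr => h _ do rewrite ez dotDl chiD chi_sqr mul1r.
    by rewrite fiber_sum mulVf // expf_neq0 // pnatr_eq0.
  rewrite (_ : t == t' = false); last by apply: contraNF nz => /eqP ->.
  (* For different phase parts, translation by [y] preserves the coset and reverses the sign of
     every term. *)
  have [y [uy vy dy]] := detect_z ht ht' nz.
  rewrite (sum_antisym (h := fun h => h + y)) ?mulr0 //; first exact: addIr.
  by move=> h _; rewrite uD vD uy vy !addr0 dotDr chiD (chi_neq0 dy) mulrN1 mulNr.
have := @has_code_isometry R H 'rV[F2]_k ('rV[F2]_b * 'rV[F2]_a)%type T B Tp
  (fun t => pauli (xp t) (zp t)) W 0 (0, 0) 1.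
apply => //.
- move=> s c c'.
  transitivity (2 ^- b * (\sum_h ((u h == c) && (v h == s.2))%:R * (c == c')%:R : R[i])).
    rewrite mulr_sumr; apply: eq_bigr => h _; rewrite conjW /W -al2.
    transitivity (al%:C%C * al%:C%C *
        (((u h == c) && (v h == s.2))%:R * ((u h == c') && (v h == s.2))%:R) *
        (chi (dotv s.1 (w h)) * chi (dotv s.1 (w h)))); first by ring.
    rewrite chi_sqr mulr1; congr (_ * _); rewrite -!natrM !mulnb; congr (nat_of_bool _)%:R.
    have [->|] := eqVneq (u h) c => //=.
    by case: (v h == s.2); rewrite ?andbT ?andbF.
  by rewrite -mulr_suml fiber_sum mulrA mulVf ?mul1r // expf_neq0 // pnatr_eq0.
- move=> s t t' c c' ht ht'.
  by under eq_bigr => h _ do rewrite !pauliW; exact: orth.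
- move=> h h'; rewrite mul1r.
  rewrite -(pair_bigA _ (fun be d => \sum_c W (be, d) h c * conjc (W (be, d) h' c))) /=.
  under eq_bigr => be _ do under eq_bigr => d _ do under eq_bigr => c _ do rewrite conjW /W /=.
  (* The sum over phase syndromes is a character sum, which vanishes unless [w h = w h']; with equal
     [u] and [v] this forces [h = h']. *)
  transitivity (\sum_be (2 ^- b * chi (dotv be (w h + w h')) *
     ((u h == u h') && (v h == v h'))%:R : R[i])).
    apply: eq_bigr => be _; rewrite (bigD1 (v h)) //= [X in _ + X]big1 => [|d hd]; last first.
      by rewrite big1 // => c _; rewrite (eq_sym (v h)) (negPf hd) andbF mulr0 mul0r.
    rewrite addr0 (bigD1 (u h)) //= [X in _ + X]big1 => [|c hc]; last first.
      by rewrite (eq_sym (u h)) (negPf hc) mulr0 mul0r.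
    rewrite addr0 !eqxx mulr1 dotvDr chiD -al2 (eq_sym (u h)) (eq_sym (v h)); ring.
  rewrite -mulr_suml -mulr_sumr sum_chi_dotv addF2_eq0 mulrA mulVf ?expf_neq0 ?pnatr_eq0 //.
  rewrite mul1r -natrM mulnb; congr (nat_of_bool _)%:R.
  apply/idP/eqP => [|->]; last by rewrite !eqxx.
  by case/andP => /eqP ew /andP[/eqP eu /eqP ev]; apply: uwv_inj; rewrite eu ew ev.
- by rewrite card_prod !card_mx !card_ord !mul1n card_H !expnD; ring.
Qed.

End CSS.

(** * The outer code *)

Section Weight.
Context {R : realType}.
Variables (N : nat) (V : finType) (v0 : V).

Definition weight (t : {ffun 'I_N -> V}) : nat := (\sum_i (t i != v0))%N.

Lemma sum_prod_ffun (F : V -> R) :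
  \sum_(t : {ffun 'I_N -> V}) \prod_i F (t i) = (\sum_v F v) ^+ N.
Proof. by rewrite -(bigA_distr_bigA (fun _ => F)) prodr_const card_ord. Qed.

Lemma prod_weight (x : R) (t : {ffun 'I_N -> V}) :
  \prod_i x ^+ (t i != v0) = x ^+ weight t.
Proof. by rewrite prodrXr. Qed.

(* Markov's inequality for [eps ^- weight]. *)
Lemma weight_tail (p : V -> R) (eps : R) (q : nat) :
  (forall v, 0 <= p v) -> \sum_v p v = 1 -> 1 - p v0 <= eps -> 0 < eps <= 1 ->
  1 - 2 ^+ N * eps ^+ q.+1 <= \sum_(t | (weight t <= q)%N) \prod_i p (t i).
Proof.
move=> p0 p1 hp /andP[e0 e1].
have tot : \sum_(t : {ffun 'I_N -> V}) \prod_i p (t i) = 1.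
  by rewrite sum_prod_ffun p1 expr1n.
rewrite -{1}tot (bigID (fun t => weight t <= q)%N) /= lerBlDr lerD2l.
apply: (@le_trans _ _ (eps ^+ q.+1 *
    \sum_(t : {ffun 'I_N -> V}) \prod_i (p (t i) * eps^-1 ^+ (t i != v0)))).
  rewrite mulr_sumr big_mkcond; apply: ler_sum => t _.
  have pr0 : 0 <= \prod_i p (t i) by apply: prodr_ge0.
  rewrite big_split prod_weight /=; case: ifP => [|_]; last first.
    by rewrite !mulr_ge0 // exprn_ge0 // ?invr_ge0 ltW.
  rewrite -ltnNge => hq; rewrite mulrCA ler_peMr // exprVn.
  rewrite ler_pdivlMr ?exprn_gt0 // mul1r.
  by apply: ler_wiXn2l => //; exact: ltW.
(* The sum factors over the blocks. Each factor is at most [1 + 1]: [p v0 <= 1], and the mass off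
   [v0], at most [eps], is multiplied by [eps^-1]. *)
rewrite (sum_prod_ffun (fun v => p v * eps^-1 ^+ (v != v0))) mulrC.
rewrite ler_pM2r ?exprn_gt0 //; apply: lerXn2r; rewrite ?nnegrE //.
  by apply: sumr_ge0 => v _; rewrite mulr_ge0 // exprn_ge0 // invr_ge0 ltW.
rewrite (bigD1 v0) //= eqxx expr0 mulr1.
under eq_bigr => v hv do rewrite hv expr1.
have hv0 : p v0 + \sum_(v | v != v0) p v = 1 by rewrite -p1 [RHS](bigD1 v0).
have s0 : 0 <= \sum_(v | v != v0) p v by apply: sumr_ge0.
rewrite -mulr_suml -[2]/(1 + 1) lerD //; first by rewrite -hv0 lerDl.
by rewrite ler_pdivrMr // mul1r; apply: le_trans hp; rewrite -hv0 addrC addKr.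
Qed.

(** A generating function bound: each [t] counted has [#|V| ^ q * #|V| ^- weight t >= 1], and the
    sum of [#|V| ^- weight t] over all [t] is a product of [N] factors at most 2. *)
Lemma card_weight_le (q : nat) :
  (#|[set t : {ffun 'I_N -> V} | (weight t <= q)%N]| <= 2 ^ N * #|V| ^ q)%N.
Proof.
have V0 : 0 < #|V|%:R :> R by rewrite ltr0n; apply/card_gt0P; exists v0.
rewrite -(ler_nat R) natrM !natrX -sum1_card natr_sum.
apply: (@le_trans _ _ (#|V|%:R ^+ q *
    \sum_(t : {ffun 'I_N -> V}) \prod_i (#|V|%:R^-1 : R) ^+ (t i != v0))).
  rewrite mulr_sumr big_mkcond; apply: ler_sum => t _; rewrite inE prod_weight.
  have hx : 0 <= #|V|%:R ^+ q * (#|V|%:R^-1 : R) ^+ weight t.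
    by rewrite mulr_ge0 // exprn_ge0 // ?invr_ge0 ltW.
  case: ifP => // hq; rewrite exprVn ler_pdivlMr ?exprn_gt0 // mul1r.
  by apply: ler_weXn2l => //; rewrite ler1n -(ltr0n R).
rewrite (sum_prod_ffun (fun v => #|V|%:R^-1 ^+ (v != v0))) mulrC.
rewrite ler_pM2r ?exprn_gt0 //; apply: lerXn2r; rewrite ?nnegrE //.
  by apply: sumr_ge0 => v _; rewrite exprn_ge0 // invr_ge0 ltW.
rewrite (bigD1 v0) //= eqxx expr0 -[2]/(1 + 1) lerD2l.
apply: (@le_trans _ _ (\sum_(v : V) #|V|%:R^-1)).
  rewrite [leRHS](bigD1 v0) //= -[leLHS]add0r lerD //.
  by apply: ler_sum => v hv; rewrite hv expr1.
by rewrite sumr_const -[_ *+ #|_|]mulr_natr mulVf // gt_eqF.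
Qed.

End Weight.

(** * Pauli weights of a channel *)

Section PauliDistribution.
Context {R : realType}.
Local Notation F2 := 'F_2.
Variables (s : nat) (B : @kraus R 'rV[F2]_s 'rV[F2]_s).

(** The diagonal of the process matrix in the Pauli basis, that is, the error distribution of the
    Pauli-twirled channel. *)
Definition pauli_prob (t : 'rV[F2]_s * 'rV[F2]_s) : R :=
  (\sum_j sqmod (\sum_h \sum_h'
     conjc (pauli (@dotv s) t.1 t.2 h h') * kop B j h h')) / #|{: 'rV[F2]_s}|%:R ^+ 2.

Lemma pauli_prob_ge0 t : 0 <= pauli_prob t.
Proof.
rewrite divr_ge0 ?exprn_ge0 //; apply: sumr_ge0 => j _; exact: sqmod_ge0.
Qed.

Lemma pauli_prob0 : pauli_prob (0, 0) = fid B.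
Proof.
congr (_ / _); apply: eq_bigr => j _; congr sqmod; apply: eq_bigr => h _ /=.
rewrite (bigD1 h) //= big1 => [|h' hh'].
  by rewrite addr0 /pauli addr0 eqxx dotvC dotv0 chi0 mulr1 conjc1 mul1r.
by rewrite /pauli addr0 eq_sym (negPf hh') mul0r conjc0 mul0r.
Qed.

Lemma parseval (f : 'rV[F2]_s -> R[i]) :
  \sum_z sqmod (\sum_h chi (dotv z h) * f h) = 2 ^+ s * \sum_h sqmod (f h).
Proof.
apply: complexI; rewrite rmorphM rmorphXn /= rmorph_nat !rmorph_sum /=.
transitivity (\sum_z \sum_h \sum_h' chi (dotv z (h + h')) * (f h * conjc (f h')) : R[i]).
  apply: eq_bigr => z _; rewrite sqmod_complex mulr_suml; apply: eq_bigr => h _.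
  rewrite rmorph_sum mulr_sumr; apply: eq_bigr => h' _.
  by rewrite rmorphM /= conj_chi dotvDr chiD; ring.
rewrite exchange_big mulr_sumr; apply: eq_bigr => h _ /=.
rewrite exchange_big /= (bigD1 h) //= -mulr_suml sum_chi_dotv addF2_eq0 eqxx mulr1.
rewrite sqmod_complex big1 ?addr0 // => h' hh'.
by rewrite -mulr_suml sum_chi_dotv addF2_eq0 eq_sym (negPf hh') mulr0 mul0r.
Qed.

(** For each shift [x], Parseval over the phases [z] leaves the squared entries at [(h + x, h)];
    over all [x] these fill whole columns, whose squared norms add up to 1 over the Kraus
    operators. *)
Lemma sum_pauli_prob : tp B -> \sum_t pauli_prob t = 1.
Proof.
move=> hB; rewrite -mulr_suml.
rewrite -(pair_bigA _ (fun x z => \sum_j sqmod (\sum_h \sum_h'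
     conjc (pauli (@dotv s) x z h h') * kop B j h h'))) /=.
have E x z j : \sum_h \sum_h' conjc (pauli (@dotv s) x z h h') * kop B j h h' =
    \sum_h chi (dotv z h) * kop B j (h + x) h.
  rewrite exchange_big; apply: eq_bigr => h _; rewrite (bigD1 (h + x)) //=.
  rewrite /pauli eqxx mul1r conj_chi big1 ?addr0 // => h' /negPf ->.
  by rewrite mul0r conjc0 mul0r.
have E2 x : \sum_z \sum_j sqmod (\sum_h \sum_h'
     conjc (pauli (@dotv s) x z h h') * kop B j h h') =
    2 ^+ s * \sum_h \sum_j sqmod (kop B j (h + x) h).
  under eq_bigr => z _ do under eq_bigr => j _ do rewrite E.
  rewrite exchange_big /=; under eq_bigr => j _ do rewrite parseval.
  by rewrite -mulr_sumr exchange_big.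
under eq_bigr => x _ do rewrite E2.
rewrite -mulr_sumr exchange_big /=.
have E3 h : \sum_x \sum_j sqmod (kop B j (h + x) h) = 1.
  rewrite -(tp_sqmod h hB) [RHS]exchange_big [RHS](reindex_inj (addrI h)) /=.
  by [].
under eq_bigr => h _ do rewrite E3.
by rewrite sumr_const card_mx mul1n card_ord natrX -expr2 divff ?expf_neq0 ?pnatr_eq0 //.
Qed.

End PauliDistribution.

Lemma eq_card_bij (T1 T2 : finType) : #|T1| = #|T2| -> exists f : T1 -> T2, bijective f.
Proof.
move=> e; exists (fun x => enum_val (cast_ord e (enum_rank x))).
exists (fun y => enum_val (cast_ord (esym e) (enum_rank y))) => x.
  by rewrite enum_valK cast_ordK enum_rankK.
by rewrite enum_valK cast_ordKV enum_rankK.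
Qed.

Section OuterCode.
Context {R : realType}.
Local Notation F2 := 'F_2.
Variables (s N k b a q : nat) (B : @kraus R 'rV[F2]_s 'rV[F2]_s).
Hypothesis Ns : (N * s = k + b + a)%N.
Hypothesis a_large : (4 * (2 ^ N * (2 ^ s) ^ (q + q)) <= 2 ^ a)%N.
Hypothesis b_large : (4 * (2 ^ N * (2 ^ s) ^ (q + q)) <= 2 ^ b)%N.
Local Notation n := (k + b + a)%N.
Local Notation V := 'rV[F2]_s.

(** Two errors on at most [q] blocks each differ on at most [q + q] blocks, so a CSS code that
    detects the vectors of that block weight corrects all of them; [weight_tail] bounds the Pauli
    weight that remains. *)
Lemma has_code_outer (eps : R) : tp B -> 1 - eps <= fid B -> 0 < eps <= 1 ->
  has_code (kraus_tens 'I_N B) 'rV[F2]_k (1 - 2 ^+ N * eps ^+ q.+1).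
Proof.
move=> hB hfid heps.
have [psi [psi' psiK psi'K]] : exists f : 'I_n -> 'I_N * 'I_s, bijective f.
  by apply: eq_card_bij; rewrite card_prod !card_ord Ns.
(* [eta] cuts a vector of [n] bits into [N] blocks of [s] bits, and [eta'] joins them again. *)
pose eta (y : 'rV[F2]_n) : {ffun 'I_N -> V} := [ffun i => \row_j y 0 (psi' (i, j))].
pose eta' (f : {ffun 'I_N -> V}) : 'rV[F2]_n := \row_c f (psi c).1 0 (psi c).2.
have etaK : cancel eta eta'.
  by move=> y; apply/rowP => c; rewrite mxE ffunE mxE -surjective_pairing psiK.
have eta'K : cancel eta' eta.
  by move=> f; apply/ffunP => i; apply/rowP => j; rewrite ffunE mxE mxE psi'K.
have etaD x y i : eta (x + y) i = eta x i + eta y i.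
  by apply/rowP => j; rewrite !ffunE !mxE.
have eta'D f g i : eta (eta' f + eta' g) i = f i + g i.
  by rewrite etaD !eta'K.
have dot_eta x y : dotv x y = \sum_i dotv (eta x i) (eta y i).
  under [RHS]eq_bigr => i _ do rewrite dotvE.
  rewrite dotvE pair_bigA /= (reindex psi') /=; last by exists psi => ? _.
  by apply: eq_bigr => -[i j] _; rewrite !ffunE !mxE.
pose wt := @weight N V 0.
pose S := [set y : 'rV[F2]_n | (wt (eta y) <= q + q)%N].
have cardS : (#|S| <= 2 ^ N * (2 ^ s) ^ (q + q))%N.
  have := @card_weight_le R N V 0 (q + q); rewrite card_mx mul1n card_ord.
  apply: leq_trans; rewrite -(card_imset S (can_inj etaK)).
  apply/subset_leq_card/fintype.subsetP => f /imsetP[y]; rewrite !inE => h ->; exact: h.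
have [||u [w [v [uD vD inj hx hz]]]] := @css_code_exists k b a S.
- by apply: leq_trans a_large; rewrite leq_mul2l cardS orbT.
- by apply: leq_trans b_large; rewrite leq_mul2l cardS orbT.
pose T := {ffun 'I_N -> (V * V)%type}.
pose Tp : pred T := fun t => (weight ((0, 0) : V * V)%R t <= q)%N.
pose xp (t : T) : 'rV[F2]_n := eta' [ffun i => (t i).1].
pose zp (t : T) : 'rV[F2]_n := eta' [ffun i => (t i).2].
have wt_add (f g : {ffun 'I_N -> V}) (t t' : T) : Tp t -> Tp t' ->
    (forall i, f i != 0 -> t i != (0, 0)) -> (forall i, g i != 0 -> t' i != (0, 0)) ->
    eta' f + eta' g \in S.
  move=> ht ht' hf hg; rewrite inE; apply: leq_trans (leq_add ht ht').
  rewrite -big_split; apply: leq_sum => i _ /=; rewrite eta'D.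
  case: (eqVneq (f i) 0) => [->|/hf ->]; last exact: leq_trans (leq_b1 _) (leq_addr _ _).
  rewrite add0r; case: (eqVneq (g i) 0) => [//|/hg ->].
  exact: leq_trans (leq_b1 _) (leq_addl _ _).
pose B' : kraus 'rV[F2]_n 'rV[F2]_n :=
  Kraus (fun j h h' => kop (kraus_tens 'I_N B) j (eta h) (eta h')).
suff : has_code B' 'rV[F2]_k (1 - 2 ^+ N * eps ^+ q.+1).
  apply: (has_code_relabel (hx := eta') (hy := eta')); [by exists eta|by exists eta|].
  by move=> y x y' x'; rewrite /choi; apply: eq_bigr => j _; rewrite /= !eta'K.
have pauli_eta t h h' : pauli (@dotv n) (xp t) (zp t) h h' =
    \prod_i pauli (@dotv s) (t i).1 (t i).2 (eta h i) (eta h' i) :> R[i].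
  rewrite big_split /= -chi_sum; congr (_ * chi _).
    transitivity ((eta h == [ffun i => eta h' i + (t i).1])%:R : R[i]).
      congr (nat_of_bool _)%:R; rewrite -(can_eq etaK); congr (_ == _).
      by apply/ffunP => i; rewrite etaD eta'K !ffunE.
    by rewrite -prod_eq_ffun; apply: eq_bigr => i _; rewrite [X in _ == X]ffunE.
  by rewrite dot_eta; apply: eq_bigr => i _; rewrite eta'K ffunE.
(* Traces against tensor products factor over the blocks, so the Pauli weights of the tensor power
   form a product distribution. *)
have prob_eta t : (\sum_j sqmod (\sum_h \sum_h'
     conjc (pauli (@dotv n) (xp t) (zp t) h h') * kop B' j h h')) /
     #|{: 'rV[F2]_n}|%:R ^+ 2 = \prod_i pauli_prob B (t i).
  rewrite /pauli_prob [RHS]big_split /= prodr_const card_ord; congr (_ * _); last first.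
    rewrite exprVn !card_mx !mul1n !card_ord -Ns !natrX -!exprM.
    by congr ((_ ^+ _)^-1); lia.
  rewrite bigA_distr_bigA /=; apply: eq_bigr => j _.
  rewrite -sqmod_prod; congr sqmod.
  rewrite bigA_distr_bigA (reindex eta') /=; last by exists eta => ? _.
  apply: eq_bigr => f _.
  rewrite bigA_distr_bigA (reindex eta') /=; last by exists eta => ? _.
  apply: eq_bigr => f' _.
  by rewrite pauli_eta rmorph_prod -big_split /=; apply: eq_bigr => i _; rewrite !eta'K.
have h1 (t : T) i : [ffun i => (t i).1] i != 0 -> t i != (0, 0).
  by rewrite ffunE; apply: contraNneq => ->.
have h2 (t : T) i : [ffun i => (t i).2] i != 0 -> t i != (0, 0).
  by rewrite ffunE; apply: contraNneq => ->.
apply: (@has_code_le _ _ _ _ _ (\sum_(t | Tp t) \prod_i pauli_prob B (t i))).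
  apply: weight_tail => //; [exact: pauli_prob_ge0|exact: sum_pauli_prob|].
  by rewrite pauli_prob0 lerBlDr addrC -lerBlDr.
under eq_bigr => t _ do rewrite -prob_eta.
apply: (@has_code_css R 'rV[F2]_n B' (@dotv n) k b a u w v T Tp xp zp) => //.
- by move=> h; apply/eqP; rewrite addF2_eq0.
- exact: dotvDl.
- exact: dotvDr.
- by rewrite card_mx mul1n card_ord.
- move=> t t' [/(can_inj eta'K)/ffunP e1 /(can_inj eta'K)/ffunP e2].
  apply/ffunP => i; have := e1 i; have := e2 i; rewrite !ffunE.
  by case: (t i) (t' i) => ? ? [? ?] /= -> ->.
- move=> t t' ht ht' nx; apply: hx; last by rewrite addF2_eq0.
  by apply: wt_add ht ht' _ _ => i; exact: h1.
- move=> t t' ht ht' nz; apply: hz; last by rewrite addF2_eq0.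
  by apply: wt_add ht ht' _ _ => i; exact: h2.
Qed.
End OuterCode.

(** * Concatenation *)

Section Concatenation.
Context {R : realType}.
Variables (X Y : finType) (A : @kraus R X Y) (x0 : X).
Hypothesis A_tp : tp A.

(** The [r] channel uses outside the [N] blocks are padded by [has_code_pad]; the rest is a
    bijection of positions. *)
Lemma has_code_blocks (N m r : nat) (U : finType) (f : R) :
  has_code (kraus_tens 'I_N (kraus_tens 'I_m A)) U f ->
  has_code (kraus_tens 'I_(N * m + r) A) U f.
Proof.
move=> /(has_code_pad [ffun=> x0] (tp_tens (I := 'I_r) A_tp)) h.
have [phi [phi' phiK phi'K]] :
    exists g : 'I_N * 'I_m + 'I_r -> 'I_(N * m + r), bijective g.
  by apply: eq_card_bij; rewrite card_sum card_prod !card_ord.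
pose split Z (g : {ffun 'I_(N * m + r) -> Z}) :
    {ffun 'I_N -> {ffun 'I_m -> Z}} * {ffun 'I_r -> Z} :=
  ([ffun i => [ffun l => g (phi (inl (i, l)))]], [ffun c => g (phi (inr c))]).
pose join Z (g : {ffun 'I_N -> {ffun 'I_m -> Z}} * {ffun 'I_r -> Z}) :
    {ffun 'I_(N * m + r) -> Z} :=
  [ffun c => match phi' c with inl p => g.1 p.1 p.2 | inr d => g.2 d end].
have split_bij Z : bijective (@split Z).
  exists (@join Z) => [g|[g1 g2]].
    apply/ffunP => c; rewrite ffunE; case e : (phi' c) => [[i l]|d] /=;
    by rewrite !ffunE -e phi'K.
  by congr (_, _); apply/ffunP => i; [apply/ffunP => l|]; rewrite !ffunE phiK.
apply: (has_code_relabel (split_bij X) (split_bij Y)) h => y x y' x'.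
rewrite choi_prod !choi_tens (reindex phi) /=; last by exists phi' => ? _.
rewrite big_sumType /=; congr (_ * _); last first.
  by apply: eq_bigr => i _; rewrite !ffunE.
under [RHS]eq_bigr => i _ do rewrite !ffunE choi_tens.
by rewrite [RHS]pair_bigA; apply: eq_bigr => -[i l] _ /=; rewrite !ffunE.
Qed.

Lemma has_code_concatenation (m K s N k b a q r : nat) (eps : R) :
  has_code (kraus_tens 'I_m A) 'I_K.+1 (1 - eps) -> 0 < eps <= 1 ->
  (2 ^ s <= K.+1)%N -> (N * s = k + b + a)%N ->
  (4 * (2 ^ N * (2 ^ s) ^ (q + q)) <= 2 ^ a)%N ->
  (4 * (2 ^ N * (2 ^ s) ^ (q + q)) <= 2 ^ b)%N ->
  has_code (kraus_tens 'I_(N * m + r) A) 'rV['F_2]_k (1 - 2 ^+ N * eps ^+ q.+1).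
Proof.
move=> [E [D [hE hD hf]]] heps hs hN ha hb.
have cardV : #|{: 'rV['F_2]_s}| = (2 ^ s)%N by rewrite card_mx mul1n card_ord.
have [E' [D' [hE' hD' hf']]] : has_code (kraus_tens 'I_m A) 'rV['F_2]_s (1 - eps).
  apply: has_code_le hf _; apply: (has_code_comp hE hD).
  by apply: has_code_sub; rewrite cardV ?expn_gt0.
apply/has_code_blocks/(has_code_tens hE' hD')/(has_code_outer hN ha hb) => //.
by do 2?[apply: tp_comp => //]; exact: tp_tens.
Qed.

End Concatenation.

(** * Passage between sequences of matrices and Kraus families *)

Section Matrices.
Context {R : realType}.

Definition kraus_of_seq (m n : nat) (K : seq 'M[R[i]]_(n, m)) : kraus 'I_m 'I_n :=
  Kraus (fun (j : 'I_(size K)) y x => tnth (in_tuple K) j y x).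

Lemma choi_of_seq (m n : nat) (K : seq 'M[R[i]]_(n, m)) y x y' x' :
  choi (kraus_of_seq K) y x y' x' = \sum_(M <- K) M y x * conjc (M y' x').
Proof. by rewrite [RHS]big_tnth. Qed.

Lemma tp_of_seq (m n : nat) (K : seq 'M[R[i]]_(n, m)) :
  trace_preserving K <-> tp (kraus_of_seq K).
Proof.
have E x x' : \sum_y choi (kraus_of_seq K) y x y x' =
    (\sum_(M <- K) (adjmx M *m M)) x' x.
  under eq_bigr => y _ do rewrite choi_of_seq.
  rewrite exchange_big summxE; apply: eq_bigr => M _.
  by rewrite mxE; apply: eq_bigr => y _; rewrite !mxE mulrC.
split => [h x x'|h]; first by rewrite E h mxE eq_sym.
by apply/matrixP => x' x; rewrite -E h mxE eq_sym.
Qed.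

Lemma choi_seq_mul (m n p : nat) (K2 : seq 'M[R[i]]_(p, n)) (K1 : seq 'M[R[i]]_(n, m))
    y x y' x' :
  choi (kraus_of_seq [seq M2 *m M1 | M2 <- K2, M1 <- K1]) y x y' x' =
  choi (kraus_comp (kraus_of_seq K2) (kraus_of_seq K1)) y x y' x'.
Proof.
rewrite choi_of_seq big_allpairs_dep /=.
rewrite /choi -(pair_bigA _ (fun j2 j1 =>
  (\sum_z tnth (in_tuple K2) j2 y z * tnth (in_tuple K1) j1 z x) *
  conjc (\sum_z tnth (in_tuple K2) j2 y' z * tnth (in_tuple K1) j1 z x'))) /=.
rewrite big_tnth; apply: eq_bigr => j2 _.
by rewrite big_tnth; apply: eq_bigr => j1 _; rewrite !mxE.
Qed.

Lemma ent_fid_of_seq (k : nat) (K : seq 'M[R[i]]_k) :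
  ent_fid K = fid (kraus_of_seq K).
Proof.
rewrite /ent_fid /fid card_ord mulr_suml big_tnth; apply: eq_bigr => j _.
rewrite /maxmixed mul_scalar_mx mxtraceZ sqmodM mulrC; congr (_ * _).
by rewrite -(rmorph_nat (real_complex R)) -fmorphV sqmod_real exprVn.
Qed.

(** The recursion follows that of [kraus_tpow], with [mxtens_unindex] splitting off one Kronecker
    factor, so that entries of the tensor power become products over digits. *)
Fixpoint digits (m n : nat) : 'I_(m ^ n) -> {ffun 'I_n -> 'I_m} :=
  match n with
  | 0 => fun _ => [ffun i : 'I_0 => False_rect 'I_m (elimF idP (ltn0 i) (ltn_ord i))]
  | n'.+1 => fun y => let p := mxtens_unindex (cast_ord (expnS m n') y) in
     [ffun i => if unlift ord0 i is Some j then digits p.2 j else p.1]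
  end.

Lemma digitsS (m n : nat) (y : 'I_(m ^ n.+1)) :
  let p := mxtens_unindex (cast_ord (expnS m n) y) in
  (digits y ord0 = p.1) * (forall i : 'I_n, digits y (lift ord0 i) = digits p.2 i).
Proof. by split => [|i]; rewrite ffunE ?unlift_none ?liftK. Qed.

Lemma digits_bij (m n : nat) : bijective (@digits m n).
Proof.
apply: inj_card_bij; last by rewrite card_ffun !card_ord.
elim: n => [|n IH] y y'.
  by move=> _; apply: val_inj; case: y y' => [[|//] hy] [[|//] hy'].
move=> e; apply: (@cast_ord_inj _ _ (expnS m n)).
apply: (can_inj (@mxtens_unindexK _ _)).
rewrite [LHS]surjective_pairing [RHS]surjective_pairing -!digitsS e; congr (_, _).
by apply: IH; apply/ffunP => i; rewrite -!digitsS e.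
Qed.

Lemma choi_tpow (m n k : nat) (K : seq 'M[R[i]]_(n, m)) y x y' x' :
  choi (kraus_of_seq (kraus_tpow K k)) y x y' x' =
  choi (kraus_tens 'I_k (kraus_of_seq K)) (digits y) (digits x) (digits y') (digits x').
Proof.
elim: k y x y' x' => [|k IH] y x y' x'.
  rewrite choi_of_seq choi_tens big_ord0 big_seq1 !mxE !(ord1 (_ : 'I_(_ ^ 0))).
  by rewrite conjc1 mulr1.
rewrite choi_of_seq choi_tens big_ord_recl big_allpairs_dep /=.
under [X in _ = _ * X]eq_bigr => i _ do rewrite !digitsS.
rewrite -choi_tens -IH !digitsS !choi_of_seq mulr_suml; apply: eq_bigr => M _.
rewrite mulr_sumr; apply: eq_bigr => M' _.
by rewrite !castmxE !esymK !mxE rmorphM mulrACA.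
Qed.

Definition seq_of_kraus (X Y : finType) (m n : nat) (gx : 'I_m -> X) (gy : 'I_n -> Y)
    (K : @kraus R X Y) : seq 'M[R[i]]_(n, m) :=
  [seq \matrix_(y, x) kop K j (gy y) (gx x) | j <- enum (kidx K)].

Lemma choi_seq_of_kraus (X Y : finType) (m n : nat) (gx : 'I_m -> X) (gy : 'I_n -> Y)
    (K : @kraus R X Y) y x y' x' :
  choi (kraus_of_seq (seq_of_kraus gx gy K)) y x y' x' =
  choi K (gy y) (gx x) (gy y') (gx x').
Proof.
rewrite choi_of_seq big_map big_enum /=.
by apply: eq_bigr => j _; rewrite !mxE.
Qed.

Lemma tp_bij (X Y X' Y' : finType) (gx : X' -> X) (gy : Y' -> Y)
    (K : @kraus R X Y) (K' : @kraus R X' Y') : injective gx -> bijective gy ->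
  (forall y x y' x', choi K' y x y' x' = choi K (gy y) (gx x) (gy y') (gx x')) ->
  tp K -> tp K'.
Proof.
move=> gx_inj gy_bij hK h x x'; under eq_bigr => y _ do rewrite hK.
by rewrite -(inj_eq gx_inj) -h [RHS](reindex gy) //=; exact: onW_bij.
Qed.

Variables (din dout n : nat) (A : seq 'M[R[i]]_(dout, din)).

Lemma code_of_has_code (U : finType) (f : R) : (0 < #|U|)%N ->
  has_code (kraus_tens 'I_n (kraus_of_seq A)) U f ->
  exists c : Defs.code R din dout n, cdim c = #|U| /\ f <= code_fid A c.
Proof.
move=> U0 hc.
have [E [D [hE hD hf]]] : has_code (kraus_of_seq (kraus_tpow A n)) U f.
  apply: has_code_relabel hc; [exact: digits_bij|exact: digits_bij|].
  exact: choi_tpow.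
have [g gU] : exists g : 'I_#|U| -> U, bijective g by apply: eq_card_bij; rewrite card_ord.
pose E' := seq_of_kraus g id E.
pose D' := seq_of_kraus id g D.
have bid T : bijective (@id T) by exists id.
have hE' : trace_preserving E'.
  apply/tp_of_seq.
  exact: (tp_bij (bij_inj gU) (bid _) (@choi_seq_of_kraus _ _ _ _ g id E)) hE.
have hD' : trace_preserving D'.
  apply/tp_of_seq.
  exact: (tp_bij (@inj_id _) gU (@choi_seq_of_kraus _ _ _ _ id g D)) hD.
exists (Code U0 hE' hD'); split => //; rewrite /code_fid /= ent_fid_of_seq.
apply: le_trans hf _; rewrite le_eqVlt; apply/orP; left; apply/eqP.
have card_eq : #|'I_#|U| | = #|U| by rewrite card_ord.
apply: complexI; rewrite !fid_choi card_eq; congr (_ / _).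
rewrite (reindex g) /=; last exact: onW_bij.
apply: eq_bigr => u _; rewrite (reindex g) /=; last exact: onW_bij.
apply: eq_bigr => u' _; rewrite choi_seq_mul !choi_comp.
apply: eq_bigr => y _; apply: eq_bigr => y' _.
rewrite choi_seq_of_kraus choi_seq_mul !choi_comp; congr (_ * _).
by apply: eq_bigr => x _; apply: eq_bigr => x' _; rewrite choi_seq_of_kraus.
Qed.

Lemma code_fid_comp (c : Defs.code R din dout n) :
  code_fid A c = fid (kraus_comp (kraus_of_seq (dec c))
    (kraus_comp (kraus_of_seq (kraus_tpow A n)) (kraus_of_seq (enc c)))).
Proof.
rewrite /code_fid ent_fid_of_seq; apply: eq_choi_fid => y x y' x'.
rewrite choi_seq_mul; apply: eq_choi_comp => // *; exact: choi_seq_mul.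
Qed.

Lemma has_code_of_code (c : Defs.code R din dout n) :
  has_code (kraus_tens 'I_n (kraus_of_seq A)) 'I_(cdim c) (code_fid A c).
Proof.
have [gx xK Kx] := digits_bij din n; have [gy yK Ky] := digits_bij dout n.
apply: (has_code_relabel (A := kraus_of_seq (kraus_tpow A n)) (hx := gx) (hy := gy)).
- by exists (@digits din n).
- by exists (@digits dout n).
- by move=> y x y' x'; rewrite choi_tpow !Kx !Ky.
exists (kraus_of_seq (enc c)), (kraus_of_seq (dec c)); split.
- exact/tp_of_seq/enc_tp.
- exact/tp_of_seq/dec_tp.
- by rewrite code_fid_comp.
Qed.

Lemma code_fid_le1 (c : Defs.code R din dout n) : trace_preserving A -> code_fid A c <= 1.
Proof.
move=> /tp_of_seq hA; rewrite code_fid_comp; apply: fid_le1.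
  by rewrite card_ord cdim_gt0.
apply: tp_comp; first exact/tp_of_seq/dec_tp.
apply: tp_comp; last exact/tp_of_seq/enc_tp.
apply: (tp_bij (K := kraus_tens 'I_n (kraus_of_seq A))).
- exact: bij_inj (digits_bij din n).
- exact: digits_bij dout n.
- exact: choi_tpow.
- exact: tp_tens.
Qed.

End Matrices.

(** * Rates and exponents *)

Section Limits.
Context {R : realType}.

Lemma limn_esup_le (u : nat -> \bar R) (c : \bar R) (N : nat) :
  (forall n, (N <= n)%N -> (u n <= c)%E) -> (limn_esup u <= c)%E.
Proof.
move=> h; apply: (@le_trans _ _ (ereal_sup (u @` [set n | (N <= n)%N]%classic))).
  by apply: ereal_inf_lbound; exists [set n | (N <= n)%N]%classic => //; exists N.
by apply: ge_ereal_sup => _ [n hn <-]; exact: h.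
Qed.

Lemma limn_einf_ge (u : nat -> \bar R) (c : \bar R) (N : nat) :
  (forall n, (N <= n)%N -> (c <= u n)%E) -> (c <= limn_einf u)%E.
Proof.
move=> h; rewrite /limn_einf leeNr; apply: (limn_esup_le (N := N)) => n hn.
by rewrite leeN2 h.
Qed.

(** A limsup gives good indices beyond any bound but not all large ones; this suffices, as a single
    block length gets fixed. *)
Lemma limn_esup_gt (u : nat -> \bar R) (c : \bar R) (N : nat) :
  (c < limn_esup u)%E -> exists2 n, (N <= n)%N & (c < u n)%E.
Proof.
move=> h; apply: contrapT => hn; move: h; rewrite ltNge => /negP; apply.
apply: (limn_esup_le (N := N)) => n hNn; rewrite leNgt; apply/negP => hu.
by apply: hn; exists n.
Qed.
End Limits.

(** * Block codes of every length and the exponent *)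

Section Main.
Context {R : realType}.

Lemma has_code_trivial (X Y : finType) (A : @kraus R X Y) (x0 : X) :
  tp A -> has_code A unit 1.
Proof.
move=> hA; pose K := kraus_comp (kdiscard Y) (kraus_comp A (kprep x0)).
exists (kprep x0), (kdiscard Y); split; [exact: tp_prep|exact: tp_discard|].
have hK : tp K by do 2?[apply: tp_comp => //]; [exact: tp_discard|exact: tp_prep].
rewrite le_eqVlt; apply/orP; left; apply/eqP/complexI.
rewrite fid_choi !sum_unit card_unit expr1n invr1 mulr1.
by have := hK tt tt; rewrite sum_unit => ->.
Qed.

Variables (din dout : nat) (A : seq 'M[R[i]]_(dout, din)).
Hypothesis A_tp : trace_preserving A.

(** With [din = 0] the encoder would map into the zero space and could not preserve the trace. *)
Lemma code_din_gt0 (n : nat) : (0 < n)%N -> Defs.code R din dout n -> (0 < din)%N.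
Proof.
move=> n0 c; have [E [D [hE _ _]]] := has_code_of_code A c.
have hsum := tp_sqmod (Ordinal (cdim_gt0 c)) hE.
have [f _] : exists f : {ffun 'I_n -> 'I_din}, true.
  apply: contrapT => hn; move: hsum.
  rewrite big1 => [/eqP|j _]; first by rewrite eq_sym oner_eq0.
  by rewrite big1 // => f _; exfalso; apply: hn; exists f.
by case: (f (Ordinal n0)) => i; exact: leq_ltn_trans.
Qed.

Lemma trivial_code (x0 : 'I_din) (n : nat) :
  exists c : Defs.code R din dout n, cdim c = 1%N /\ code_fid A c = 1.
Proof.
have [||c [hc hf]] := @code_of_has_code R din dout n A unit 1.
- by rewrite card_unit.
- by apply: (has_code_trivial [ffun=> x0]); exact/tp_tens/tp_of_seq.
exists c; split; first by rewrite hc card_unit.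
by apply/le_anti; rewrite hf code_fid_le1.
Qed.

(** [a] counts the checks of each kind: its summands pay for the factors [2 ^ N],
    [(2 ^ s) ^ (q + q)] and [4] in the size condition of the outer code, with [q = N %/ u]. *)
Lemma block_code (x0 : 'I_din) (m s u : nat) (c : Defs.code R din dout m) (n : nat) :
  let N := (n %/ m)%N in
  let a := (N + s * (N %/ u + N %/ u) + 2)%N in
  (0 < u)%N -> (2 ^ s <= cdim c)%N -> 1 - code_fid A c <= 4^-1 ^+ u ->
  (a + a <= N * s)%N ->
  exists c' : Defs.code R din dout n,
    cdim c' = (2 ^ (N * s - (a + a)))%N /\ 1 - code_fid A c' <= 2^-1 ^+ N.
Proof.
move=> N a u0 hs hf ha; pose q := (N %/ u)%N; pose k := (N * s - (a + a))%N.
have eps01 : 0 < (4^-1 : R) ^+ u <= 1.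
  by rewrite exprn_gt0 ?invr_gt0 //= exprn_ile1 ?invr_ge0 ?invf_le1 ?ler1n.
have [] := @code_of_has_code R din dout n A 'rV['F_2]_k (1 - 2 ^+ N * (4^-1 ^+ u) ^+ q.+1).
- by apply/card_gt0P; exists 0.
- rewrite (divn_eq n m) -/N.
  have hc : has_code (kraus_tens 'I_m (kraus_of_seq A)) 'I_(cdim c).-1.+1 (1 - 4^-1 ^+ u).
    rewrite prednK ?cdim_gt0 //; apply: has_code_le (has_code_of_code A c).
    by rewrite lerBlDr addrC -lerBlDr.
  have hpow : (4 * (2 ^ N * (2 ^ s) ^ (q + q)) <= 2 ^ a)%N.
    by rewrite -expnM /a addnC -/q !expnD mulnA.
  apply: (@has_code_concatenation R _ _ (kraus_of_seq A) x0 _ m (cdim c).-1 s N k a a) => //.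
  + exact/tp_of_seq.
  + by rewrite prednK ?cdim_gt0.
  + by rewrite /k -addnA subnK.
move=> c' [hdim hfid]; exists c'; split.
  by rewrite hdim card_mx mul1n card_ord.
rewrite lerBlDr addrC -lerBlDr; apply: le_trans hfid; rewrite lerD2l lerN2.
(* Since [u * q.+1 >= N], the infidelity is at most [2 ^ N * 4 ^- N]. *)
rewrite -exprM; apply: (@le_trans _ _ (2 ^+ N * 4^-1 ^+ N)).
  rewrite ler_pM2l ?exprn_gt0 //; apply: ler_wiXn2l; rewrite ?invr_ge0 ?invf_le1 ?ler1n //.
  by rewrite mulnC; apply/ltnW/ltn_ceil.
by rewrite -exprMn (_ : 2 * 4^-1 = 2^-1) //; field.
Qed.

End Main.

(* The rate bookkeeping, with logarithms cleared: [rho1] and [rho] are the inner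
   rate and the target rate in nats, [S] is the number of qubits per block in
   nats, and [N], [q], [n] are the numbers of blocks, of correctable block errors
   and of channel uses. *)
Lemma rate_bound (R : realType) (rho rho1 l S m u N q n : R) :
  0 <= rho -> rho < rho1 -> 0 < l -> 0 < m -> 4 <= u ->
  8 * rho1 <= u * (rho1 - rho) -> 3 * l + 1 <= m * (rho1 - rho) / 2 ->
  m * rho1 - l <= S -> 0 <= q -> q * u <= N -> 4 * l + rho * m <= N -> n <= N * m + m ->
  rho * n <= N * S - 4 * q * S - (2 * N + 4) * l.
Proof.
move=> rho0 rho01 l0 m0 u4 hu hm hS q0 hq hN hn.
have u0 : 0 < u by lra.
have N0 : 0 <= N by apply: le_trans hN; rewrite addr_ge0 ?mulr_ge0 // ltW.
(* [t] bounds the fraction of the rate spent on detecting [2 * q] block errors, of both kinds. *)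
pose t := 4 / u.
have t0 : 0 <= t by rewrite divr_ge0 // ltW.
have t1 : t <= 1 by rewrite ler_pdivrMr // mul1r.
have ht : t * rho1 <= (rho1 - rho) / 2.
  rewrite /t mulrAC ler_pdivrMr //; lra.
have hqt : 4 * q <= t * N.
  by rewrite /t mulrAC ler_pdivlMr // -mulrA ler_wpM2l.
have S0 : 0 <= S by apply: le_trans hS; nra.
have h1 : N * S - 4 * q * S >= N * ((1 - t) * S) by nra.
have h2 : (1 - t) * S >= m * (rho + (rho1 - rho) / 2) - l.
  have : (1 - t) * (m * rho1 - l) <= (1 - t) * S by rewrite ler_wpM2l // subr_ge0.
  have : m * (t * rho1) <= m * ((rho1 - rho) / 2) by rewrite ler_wpM2l // ltW.
  nra.
have h3 : N * ((1 - t) * S) >= N * (m * (rho + (rho1 - rho) / 2) - l) by rewrite ler_wpM2l.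
have h4 : rho * n <= rho * (N * m + m) by rewrite ler_wpM2l.
(* Of the surplus per block, [3 * l] pays for rounding to whole qubits and for the term [2 * N * l];
   the remaining 1 per block adds up to [N], which covers [4 * l] and the incomplete last block. *)
have h5 : N * (3 * l + 1) <= N * (m * (rho1 - rho) / 2) by rewrite ler_wpM2l.
nra.
Qed.

Theorem theorem2 (R : realType) (d din dout : nat) (A : seq 'M[R[i]]_(dout, din)) :
  prime d -> trace_preserving A ->
  forall r : R, (r%:E < quantum_capacity d A)%E ->
  exists E : R, 0 < E /\ attainable_exponent d A E r.
Proof.
move=> pr_d A_tp r /ereal_sup_gt[_ [r' [c [hrate hfid]] <-]]; rewrite lte_fin => rr'.
have x0 : 'I_din := Ordinal (code_din_gt0 A (ltn0Sn 0) (c 1%N)).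
have L0 : 0 < ln (d%:R : R) by rewrite ln_gt0 // ltr1n prime_gt1.
set L := ln (d%:R : R) in L0.
(* For negative rates one-dimensional codes suffice: their infidelity is 0, where [err_exponent] is
   [+oo]. Below, [rho] is then nonnegative. *)
have [r_lt0|r_ge0] := ltP r 0.
  exists 1; split => //.
  exists (fun n => sval (cid (trivial_code A_tp x0 n))); split.
    apply: (limn_einf_ge (N := 0)) => n _; case: cid => c' /= [-> _].
    by rewrite lee_fin /code_rate ln1 !mul0r ltW.
  apply: (limn_einf_ge (N := 0)) => n _; case: cid => c' /= [_ ->].
  by rewrite subrr /err_exponent eqxx leey.
pose l := ln (2 : R); have l0 : 0 < l by rewrite ln_gt0 // ltr1n.
pose r1 := (r + r') / 2; pose rho := r * L; pose rho1 := r1 * L.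
have rr1 : r < r1 by rewrite /r1; lra.
have r1r' : r1 < r' by rewrite /r1; lra.
have rho01 : rho < rho1 by rewrite ltr_pM2r.
have rho0 : 0 <= rho by rewrite mulr_ge0 // ltW.
pose D := rho1 - rho; have D0 : 0 < D by rewrite subr_gt0.
(* [u] depends only on the rates, so the infidelity [4 ^- u] asked of the inner code is fixed before
   its length [m]. The value meets the two conditions on [u] in [rate_bound]. *)
pose u := (Num.truncn (8 * rho1 / D) + 4).+1.
have hu : 8 * rho1 <= u%:R * D.
  rewrite -ler_pdivrMr //; apply/ltW/(lt_le_trans (truncnS_gt _)).
  by rewrite /u ler_nat ltnS leq_addr.
have u4 : 4 <= u%:R :> R by rewrite ler_nat /u leqW // leq_addl.
have eps0 : 0 < (4^-1 : R) ^+ u by rewrite exprn_gt0 // invr_gt0.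
have [M1 _ hM1] : exists2 M, True & forall m, (M <= m)%N -> 1 - code_fid A (c m) <= 4^-1 ^+ u.
  move/cvgrPdist_le : hfid => /(_ _ eps0)[M _ hM]; exists M => // m hm.
  exact: le_trans (ler_norm _) (hM m hm).
(* From this length on, half the rate gap covers the overhead [3 * l + 1] per block. *)
pose M2 := (Num.truncn ((3 * l + 1) * 2 / D)).+1.
have [m hm hrm] : exists2 m, (maxn M1 M2 <= m)%N &
    ((r1%:E < (code_rate R d m (cdim (c m)))%:E))%E.
  by apply: limn_esup_gt; apply: lt_le_trans hrate; rewrite lte_fin.
move: hm; rewrite geq_max => /andP[/hM1 {}hM1 hM2].
have m0 : (0 < m)%N by apply: leq_trans hM2.
have m0R : 0 < m%:R :> R by rewrite ltr0n.
have hmD : 3 * l + 1 <= m%:R * D / 2.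
  rewrite ler_pdivlMr // -ler_pdivrMr //; apply/ltW/(lt_le_trans (truncnS_gt _)).
  by rewrite ler_nat.
pose K := cdim (c m); have K0 : (0 < K)%N := cdim_gt0 (c m).
have hK : m%:R * rho1 < ln (K%:R : R).
  move: hrm; rewrite lte_fin /code_rate -/L -/K ltr_pdivlMr // ltr_pdivlMr //.
  by rewrite /rho1 mulrA (mulrC m%:R).
pose s := trunc_log 2 K; have hs : (2 ^ s <= K)%N by exact: trunc_logP.
(* Rounding down to a power of 2 costs at most one qubit, [l] in nats. *)
have hsl : m%:R * rho1 - l <= s%:R * l.
  rewrite lerBlDr -{2}[l]mul1r -mulrDl natr1; apply/ltW/(lt_le_trans hK).
  rewrite mulr_natl -lnXn // ler_ln ?posrE ?exprn_gt0 ?ltr0n //.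
  by rewrite -natrX ler_nat ltnW // trunc_log_ltn.
pose nn n := (n %/ m)%N; pose aa n := (nn n + s * (nn n %/ u + nn n %/ u) + 2)%N.
(* For small [n] the checks may outnumber the qubits; such lengths get a one-dimensional code and do
   not affect the limits. *)
pose good n (c' : Defs.code R din dout n) := (aa n + aa n <= nn n * s)%N ->
  cdim c' = (2 ^ (nn n * s - (aa n + aa n)))%N /\ 1 - code_fid A c' <= 2^-1 ^+ nn n.
have good_ex n : exists c', @good n c'.
  have [ha|ha] := boolP (aa n + aa n <= nn n * s)%N.
    by have [c' hc'] := block_code A_tp x0 (ltn0Sn _) hs hM1 ha; exists c' => _.
  by have [c' _] := trivial_code A_tp x0 n; exists c'; rewrite /good (negPf ha).
pose N0 := (Num.truncn (4 * l + rho * m%:R)).+1.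
have large n : (N0 * m <= n)%N -> [/\ 0 < n%:R :> R, (0 < nn n)%N,
    (aa n + aa n <= nn n * s)%N & rho * n%:R <= (nn n * s - (aa n + aa n))%:R * l].
  move=> hn; have hN : (N0 <= nn n)%N by rewrite leq_divRL.
  suff hk : rho * n%:R <= ((nn n * s)%:R - (aa n + aa n)%:R) * l.
    have ha : (aa n + aa n <= nn n * s)%N.
      rewrite -(ler_nat R) -subr_ge0 -(pmulr_lge0 _ l0); apply: le_trans hk.
      by rewrite mulr_ge0.
    have N1 : (0 < nn n)%N by exact: leq_trans hN.
    split => //; last by rewrite natrB.
    by rewrite ltr0n; case: (n) N1 => //; rewrite /nn div0n.
  have := @rate_bound R rho rho1 l (s%:R * l) m%:R u%:R (nn n)%:R (nn n %/ u)%:R n%:R.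
  rewrite (_ : _ - _ - _ = ((nn n * s)%:R - (aa n + aa n)%:R) * l); last first.
    by rewrite /aa !natrD !natrM !natrD; ring.
  apply => //.
  - by rewrite -natrM ler_nat leq_divM.
  - by apply/ltW/(lt_le_trans (truncnS_gt _)); rewrite ler_nat.
  - by rewrite -natrM -natrD ler_nat; apply/ltnW; rewrite -mulSnr ltn_ceil.
(* The infidelity is at most [2 ^- nn n], and [nn n >= n / (2 * m)] once [nn n] is positive;
   dividing by [L] passes to base [d]. *)
exists (l / (2 * m%:R * L)); split; first by rewrite divr_gt0 // !mulr_gt0.
exists (fun n => sval (cid (good_ex n))); split.
  apply: (limn_einf_ge (N := N0 * m)) => n hn; case: cid => c' /= hc'.
  have [n0 _ ha hk] := large n hn; have [-> _] := hc' ha.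
  rewrite lee_fin /code_rate -/L !ler_pdivlMr // natrX lnXn // -/l.
  by rewrite -[l *+ _]mulr_natl mulrAC.
apply: (limn_einf_ge (N := N0 * m)) => n hn; case: cid => c' /= hc'.
have [n0 N1 ha _] := large n hn; have [_ hx] := hc' ha.
rewrite /err_exponent; case: eqP => [_|/eqP x0']; first exact: leey.
have xpos : 0 < 1 - code_fid A c'.
  by rewrite lt_neqAle eq_sym x0' subr_ge0 code_fid_le1.
have lnx : (nn n)%:R * l <= - ln (1 - code_fid A c').
  rewrite lerNr -mulrN -lnV ?posrE // mulr_natl -lnXn ?invr_gt0 //.
  by rewrite ler_ln // posrE exprn_gt0 // invr_gt0.
rewrite lee_fin -/L -mulNr ler_pdivlMr // ler_pdivlMr //; apply: le_trans lnx.
have hnm : n%:R <= 2 * m%:R * (nn n)%:R :> R.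
  rewrite -!natrM ler_nat; apply: (@leq_trans ((nn n).+1 * m)).
    by rewrite ltnW // ltn_ceil.
  by rewrite mulnAC leq_mul2r mul2n -addnn -addn1 leq_add2l N1 orbT.
rewrite (_ : _ * _ * _ = n%:R / (2 * m%:R) * l); last by field; rewrite !gt_eqF.
by rewrite ler_pM2r // ler_pdivrMr ?mulr_gt0 // mulrC.
Qed.
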